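(* Let $G=([n],E)$ be a natural unit interval graph. Then its chromatic quasisymmetric function satisfies $$X_G(\mathbf x;q)=\sum_{\mathcal F\in\mathrm{FT}(G)}\mathrm{sign}(\mathcal F)\,q^{\mathrm{weight}(\mathcal F)}\,e_{\mathrm{type}(\mathcal F)}=\sum_\mu\Big(\sum_{\mathcal F\in\mathrm{FT}_\mu(G)}\mathrm{sign}(\mathcal F)\,q^{\mathrm{weight}(\mathcal F)}\Big)e_\mu .$$
   Context: A graph $G=([n],E)$ is a natural unit interval graph if for all $1\le i<j<k\le n$, $\{i,k\}\in E$ implies $\{i,j\}\in E$ and $\{j,k\}\in E$. The chromatic quasisymmetric function is $X_G(\mathbf x;q)=\sum_{\kappa}q^{\mathrm{asc}(\kappa)}x_{\kappa(1)}\cdots x_{\kappa(n)}$, summed over proper colourings $\kappa:[n]\to\{1,2,\dots\}$ (i.e. $\kappa(i)\neq\kappa(j)$ whenever $\{i,j\}\in E$), where $\mathrm{asc}(\kappa)$ is the number of pairs $(i,j)$ with $i<j$, $\{i,j\}\in E$ and $\kappa(i)<\kappa(j)$. For natural unit interval graphs it is symmetric in $\mathbf x$. $e_k=\sum_{i_1<\dots<i_k}x_{i_1}\cdots x_{i_k}$ and $e_\mu=e_{\mu_1}e_{\mu_2}\cdots$. A decreasing subtree of $G$ is a subgraph $T$ of $G$ which is a tree (with nonempty vertex set) such that every vertex of $T$ other than the largest vertex of $T$ has exactly one neighbour in $T$ larger than itself. For such $T$, $\mathrm{list}(T)$ is the permutation of $V(T)$ obtained by reading first the smallest vertex of $T$,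 and at each subsequent step reading the smallest unread vertex of $T$ that is adjacent in $T$ to an already read vertex. A tree triple of $G$ is $(T,\alpha,r)$ with $T$ a decreasing subtree of $G$, $\alpha=\alpha_1\cdots\alpha_\ell$ an integer composition with $|\alpha|=|V(T)|$, and $1\le r\le\alpha_1$. A forest triple of $G$ is a sequence $\mathcal F=((T_i,\alpha^{(i)},r_i))_{i=1}^m$ of tree triples such that every vertex of $G$ lies in exactly one $T_i$ and $\min V(T_1)<\min V(T_2)<\dots<\min V(T_m)$. Its type $\mathrm{type}(\mathcal F)$ is the partition obtained by sorting the parts of the concatenation $\alpha^{(1)}\cdots\alpha^{(m)}$ in decreasing order; its sign is $\mathrm{sign}(\mathcal F)=(-1)^{\sum_{i=1}^m(\ell(\alpha^{(i)})-1)}$; its weight is $\mathrm{weight}(\mathcal F)=\mathrm{inv}_G(\sigma)+\sum_{i=1}^m(r_i-1)$, where $\sigma=\mathrm{list}(T_1)\cdots\mathrm{list}(T_m)\in S_n$ is the concatenation and $\mathrm{inv}_G(\sigma)=|\{(i,j):i<j,\ \sigma_i>\sigma_j,\ \{\sigma_j,\sigma_i\}\in E\}|$. $\mathrm{FT}(G)$ is the set of forest triples of $G$ and $\mathrm{FT}_\mu(G)$ those of type $\mu$. *)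

(* Defs.v *)
From HB Require Import structures.
From mathcomp Require Import all_boot all_order all_algebra.
From mathcomp Require Import finmap multiset.

Set Implicit Arguments.
Unset Strict Implicit.
Unset Printing Implicit Defensive.

Import GRing.Theory.
Local Open Scope nat_scope.

(* The vertex set [n] is 'I_n = {0, ..., n-1}, the colours are 0, 1, 2, ...,
   and the variables are x_0, x_1, x_2, ...; all indices are thus shifted by
   one.  A finite graph on [n] is a symmetric irreflexive G : rel 'I_n. *)

(* -------------------------------------------------------------------------- *)
(* Formal power series in x_0, x_1, ... with coefficients in Z[q]             *)
(* -------------------------------------------------------------------------- *)

(* The monomial prod_i x_i^(m i) is the multiset m, and a formal power series
   is the family of its coefficients.  Two series are equal when they are
   equal pointwise (=1).  The indeterminate q is 'X : {poly int}. *)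
Definition series := {mset nat}%mset -> {poly int}.

Definition monomial (s : seq nat) : {mset nat}%mset := seq_mset s.

(* The divisors of the monomial m, see [mem_divisors_mset]. *)
Definition divisors_mset (m : {mset nat}%mset) : seq {mset nat}%mset :=
  undup [seq seq_mset (mask b m) | b : (size m).-tuple bool].

Definition series1 : series := fun m => ((m == mset0)%:R)%R.

Definition series_mul (f g : series) : series :=
  fun m => (\sum_(a <- divisors_mset m) f a * g (m `\` a)%mset)%R.

(* Every index of a variable occurring in the monomial m lies in finsupp m, so
   that the coefficient of m only involves i_1 < ... < i_k in finsupp m, and
   the same holds for colourings in [chromatic_qsym]; cf.
   [mem_finsupp_monomial]. *)
Definition elem_sym (k : nat) : series := fun m =>
  (\sum_(i : k.-tuple (finsupp m) |
         sorted ltn (map val i) && (monomial (map val i) == m)) 1)%R.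

Definition elem_sym_part (mu : seq nat) : series :=
  foldr series_mul series1 (map elem_sym mu).

Lemma mem_divisors_mset (m a : {mset nat}%mset) :
  (a \in divisors_mset m) = (a `<=` m)%mset.
Proof.
rewrite mem_undup; apply/imageP/idP => [[b _ ->]|/msubsetP le_am].
  apply/msubsetP => x; rewrite mset_seqE -[X in _ <= X]count_mem_mset.
  by rewrite leq_count_subseq ?mask_subseq.
have [b /eqP sz_b perm_ab] :
    exists2 b : bitseq, size b = size m & perm_eq a (mask b m).
  by apply/count_maskP => x; rewrite !count_mem_mset.
exists (Tuple sz_b) => //=; rewrite -[LHS]seq_mset_id.
exact/eq_seq_msetP.
Qed.

Lemma mem_finsupp_monomial (s : seq nat) (x : nat) :
  (x \in finsupp (monomial s)) = (x \in s).
Proof. by rewrite msuppE in_mset mset_seqE -has_count has_pred1. Qed.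

(* -------------------------------------------------------------------------- *)
(* The chromatic quasisymmetric function                                      *)
(* -------------------------------------------------------------------------- *)

Definition natural_unit_interval (n : nat) (G : rel 'I_n) : Prop :=
  forall i j k : 'I_n, i < j -> j < k -> G i k -> G i j /\ G j k.

Definition proper_colouring (n : nat) (G : rel 'I_n) (kappa : 'I_n -> nat) :=
  [forall i, forall j, G i j ==> (kappa i != kappa j)].

Definition asc (n : nat) (G : rel 'I_n) (kappa : 'I_n -> nat) : nat :=
  #|[set p : 'I_n * 'I_n |
      [&& p.1 < p.2, G p.1 p.2 & kappa p.1 < kappa p.2]]|.

Definition chromatic_qsym (n : nat) (G : rel 'I_n) : series := fun m =>
  (\sum_(kappa : {ffun 'I_n -> finsupp m} |
         proper_colouring G (fun i => val (kappa i)) &&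
         (monomial [seq val (kappa i) | i <- enum 'I_n] == m))
     'X^(asc G (fun i => val (kappa i))))%R.

(* -------------------------------------------------------------------------- *)
(* Decreasing subtrees                                                        *)
(* -------------------------------------------------------------------------- *)

(* A pair of a set of vertices and a set of edges, each edge being given as the
   set of its two endpoints. *)
Definition pregraph (n : nat) : finType :=
  ({set 'I_n} * {set {set 'I_n}})%type.

Section Trees.
Variable n : nat.
Implicit Types (G : rel 'I_n) (T : pregraph n).

Definition verts T : {set 'I_n} := T.1.
Definition edges T : {set {set 'I_n}} := T.2.

Definition adj T : rel 'I_n := fun x y => [set x; y] \in edges T.

Definition is_subgraph G T :=
  [forall A in edges T, exists x in verts T, exists y in verts T,
     G x y && (A == [set x; y])].

(* Nonempty, connected and acyclic.  A cycle is a closed walk through at least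
   three vertices that are pairwise distinct, hence at most n in number. *)
Definition is_tree T :=
  [&& verts T != set0,
      [forall x in verts T, forall y in verts T, connect (adj T) x y] &
      [forall c : {bseq n of 'I_n}, (2 < size c) ==> ~~ ucycleb (adj T) c]].

Definition is_decreasing T :=
  [forall x in verts T, [exists y in verts T, x < y] ==>
     (#|[set y in verts T | (x < y) && adj T x y]| == 1)].

Definition decreasing_subtree G T :=
  [&& is_subgraph G T, is_tree T & is_decreasing T].

(* enum lists the elements of a set of 'I_n in increasing order, so that the
   head of such a list is the smallest element. *)
Definition list_step T (read : seq 'I_n) : seq 'I_n :=
  if [seq y <- enum (verts T) | (y \notin read) && has (fun x => adj T x y) read]
  is y :: _ then rcons read y else read.

Definition tree_list T : seq 'I_n :=
  iter #|verts T|.-1 (list_step T) (take 1 (enum (verts T))).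

Definition min_vert T : nat := head 0 [seq val x | x <- enum (verts T)].

End Trees.

(* -------------------------------------------------------------------------- *)
(* Tree triples and forest triples                                            *)
(* -------------------------------------------------------------------------- *)

(* The parts of a composition (or partition) of an integer at most n, and their
   number, are at most n: such compositions lie in the finite type
   {bseq n of 'I_n.+1}. *)
Definition pretriple (n : nat) : finType :=
  (pregraph n * {bseq n of 'I_n.+1} * 'I_n.+1)%type.

Section Triples.
Variable n : nat.
Implicit Types (G : rel 'I_n) (t : pretriple n).

Definition tree_of t : pregraph n := t.1.1.
Definition comp_of t : seq nat := [seq val a | a <- val t.1.2].
Definition r_of t : nat := val t.2.

Definition tree_triple G t :=
  [&& decreasing_subtree G (tree_of t),
      all (leq 1) (comp_of t),
      sumn (comp_of t) == #|verts (tree_of t)| &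
      1 <= r_of t <= head 0 (comp_of t)].

(* The trees are nonempty and disjoint, hence at most n in number. *)
Definition preforest := {bseq n of pretriple n}.

Implicit Types F : preforest.

Definition forest_triple G F :=
  [&& all (tree_triple G) F,
      [forall v : 'I_n, count (fun t => v \in verts (tree_of t)) F == 1] &
      sorted ltn [seq min_vert (tree_of t) | t <- F]].

Definition FT G : {set preforest} := [set F | forest_triple G F].

Definition ftype F : seq nat :=
  sort geq (flatten [seq comp_of t | t <- F]).

Definition FT_type G (mu : seq nat) : {set preforest} :=
  [set F in FT G | ftype F == mu].

Definition fsign F : {poly int} :=
  ((-1) ^+ (\sum_(t <- F) (size (comp_of t)).-1)%N)%R.

Definition inv G (s : seq 'I_n) : nat :=
  #|[set p : 'I_(size s) * 'I_(size s) |
      let si := tnth (in_tuple s) p.1 in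
      let sj := tnth (in_tuple s) p.2 in
      [&& p.1 < p.2, sj < si & G sj si]]|.

Definition fperm F : seq 'I_n := flatten [seq tree_list (tree_of t) | t <- F].

Definition fweight G F : nat :=
  inv G (fperm F) + \sum_(t <- F) (r_of t).-1.

End Triples.

Definition is_partition (n : nat) (mu : seq nat) :=
  [&& sorted geq mu, all (leq 1) mu & sumn mu == n].

(* Main.v *)
Require Import Defs.
From mathcomp Require Import all_boot all_order all_algebra.
From mathcomp Require Import finmap multiset.
From mathcomp Require mpoly.
From mathcomp Require Import ring zify.

(** Fix variables [x_0, ..., x_(N-1)] and let [X_j(W)] be the generating function
    of the proper colourings of the vertex set [W] with the first [j] colours.
    Let [Q_k = \sum_alpha (-1)^(l(alpha)-1) [alpha_1]_q e_alpha], over the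
    compositions [alpha] of [k], and [c_B = \prod_v [d_v]_q], over the vertices
    [v <> min B] of [B], where [d_v] is the number of smaller neighbours of [v]
    in [B].  Both sides of the theorem satisfy
      [X(W) = \sum_(B contains min W) c_B Q_|B| q^(inv(B, W \ B)) X(W \ B)].
    For forest triples one peels off the first tree triple: reading decreasing
    subtrees on [B] as lists is a bijection onto the sequences that start with
    [min B], in which every other vertex has an earlier neighbour and each
    descent is an edge; inserting the largest vertex shows that their
    inversion generating function is [c_B].
    For colourings the recursion is proved by adding one colour at a time.  Its
    two sides then differ by an identity for sums over the independent subsets
    of a set [U] with [x = min W < min U], which is proved by induction on [U],
    adding the largest vertex; the smaller neighbours of that vertex form an
    upper clique, and the induction needs a relation for such cliques as well. *)

Set Implicit Arguments.
Unset Strict Implicit.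
Unset Printing Implicit Defensive.

Import GRing.Theory.

(** Let E(t) and Q(t) be the generating series of the elementary symmetric functions and of the Q_k.
    Since (1 - q) [k]_q = 1 - q^k, one has 1 - (1 - q) Q(t) = E(q t) / E(t), so adjoining a variable
    y multiplies this series by (1 + q y t) / (1 + y t). Hence Q'_1 = Q_1 + y and Q'_(k+1) + y Q'_k
    = Q_(k+1) + q y Q_k for k >= 1. These relations, and the vanishing of the Q_k in no variables,
    are all that the colouring side uses. To exploit them the factor Q_|B| is kept symbolic: a block
    B is weighted by z^(|B|-1), and only at the end z^k is replaced by Q_(k+1) on one side and by
    Q'_(k+1) on the other. Under these substitutions z + q y and z + y have the same effect. The
    sums over independent sets therefore only have to be of the form (z + q y) tau + i and (z + y)
    tau + i with common tau and i; replacing Q_1 by Q'_1 in the constant i accounts for the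
    colourings that give the new colour to x. No closed form of tau is at hand; it is built along
    the induction. *)

Section Basics.
Local Open Scope ring_scope.
Variables (A : comNzRingType) (q : A).

Definition qnum (k : nat) : A := \sum_(i < k) q ^+ i.

Lemma qnum0 : qnum 0 = 0. Proof. by rewrite /qnum big_ord0. Qed.
Lemma qnumSr k : qnum k.+1 = qnum k + q ^+ k.
Proof. by rewrite /qnum big_ord_recr. Qed.
Lemma qnumS k : qnum k.+1 = 1 + q * qnum k.
Proof.
rewrite /qnum big_ord_recl expr0 big_distrr; congr (_ + _).
by apply: eq_bigr => i _; rewrite exprS.
Qed.
Lemma qnum_geom k : q ^+ k = 1 + (q - 1) * qnum k.
Proof. have := qnumS k; rewrite qnumSr => /(canRL (addKr _)) ->; ring. Qed.

Lemma sum_subset_setU1 (I : finType) (v : I) (U : {set I}) (F : {set I} -> A) :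
  v \notin U ->
  \sum_(S : {set I} | S \subset v |: U) F S =
  \sum_(S : {set I} | S \subset U) F S + \sum_(S : {set I} | S \subset U) F (v |: S).
Proof.
move=> vU; rewrite (bigID (fun S : {set I} => v \notin S)) /=; congr (_ + _).
  apply: eq_bigl => S; rewrite -subsetD1; congr (S \subset _).
  by rewrite setU1K.
rewrite (reindex_onto (fun S => v |: S) (fun S => S :\ v)) /=; last first.
  by move=> S; rewrite negbK => /andP[_ vS]; rewrite setD1K.
apply: eq_bigl => S; rewrite setU11 /= andbT.
apply/andP/idP => [[SU /eqP eqS]|SU].
  by rewrite -eqS -(setU1K vU) setSD.
split; first exact: setUS.
by apply/eqP; apply: setU1K; apply: contra vU => /(subsetP SU).
Qed.

End Basics.

(** * Smaller neighbours, inversions between two sets, independent sets *)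

Section Graph.
Variables (n : nat) (G : rel 'I_n).
Implicit Types (S T U D B W : {set 'I_n}) (u v w x y : 'I_n).

Definition lower_nbrs B v : {set 'I_n} := [set w in B | (w < v) && G w v].

(** For disjoint sets these are the inversions between a list of [S] and a list of [T] that follows
    it. They are also the ascents from [T] to [S] when [S] carries a colour above all colours of
    [T]. *)
Definition cross_inv S T : nat := \sum_(u in S) #|lower_nbrs T u|.

Definition indep S : bool := [forall u in S, forall w in S, ~~ G u w].

Lemma lower_nbrsU B1 B2 v :
  lower_nbrs (B1 :|: B2) v = lower_nbrs B1 v :|: lower_nbrs B2 v.
Proof. by apply/setP=> w; rewrite !inE andb_orl. Qed.

Lemma card_lower_nbrsU B1 B2 v : [disjoint B1 & B2] ->
  #|lower_nbrs (B1 :|: B2) v| = #|lower_nbrs B1 v| + #|lower_nbrs B2 v|.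
Proof.
move=> dis; rewrite lower_nbrsU cardsU.
suff -> : lower_nbrs B1 v :&: lower_nbrs B2 v = set0 by rewrite cards0 subn0.
apply/setP=> w; rewrite !inE; apply/negP=> /andP[/andP[w1 _] /andP[w2 _]].
by move/pred0P: dis => /(_ w) /=; rewrite w1 w2.
Qed.

Lemma cross_invUr S T1 T2 : [disjoint T1 & T2] ->
  cross_inv S (T1 :|: T2) = cross_inv S T1 + cross_inv S T2.
Proof.
move=> dis; rewrite /cross_inv -big_split.
by apply: eq_bigr => u _; rewrite card_lower_nbrsU.
Qed.

Lemma cross_invUl S1 S2 T : [disjoint S1 & S2] ->
  cross_inv (S1 :|: S2) T = cross_inv S1 T + cross_inv S2 T.
Proof.
move=> dis; rewrite /cross_inv -bigU //=.
by apply: eq_bigl => u; rewrite !inE.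
Qed.

Lemma cross_inv1 v T : cross_inv [set v] T = #|lower_nbrs T v|.
Proof. by rewrite /cross_inv big_set1. Qed.

Lemma cross_inv0l T : cross_inv set0 T = 0.
Proof. by rewrite /cross_inv big_set0. Qed.

Lemma lower_nbrs_ge v w : (w <= v) -> lower_nbrs [set v] w = set0.
Proof. by move=> vw; apply/setP=> u; rewrite !inE; case: eqP => //= ->; rewrite ltnNge vw. Qed.

Lemma cross_inv_ge S v : {in S, forall u, u <= v} -> cross_inv S [set v] = 0.
Proof.
move=> Sv; rewrite /cross_inv big1 // => u uS.
by rewrite lower_nbrs_ge ?cards0 ?Sv.
Qed.

Lemma indepP S : reflect {in S &, forall u w, ~~ G u w} (indep S).
Proof.
apply: (iffP forall_inP) => H u => [w uS|uS]; first by have/forall_inP := H u uS; apply.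
by apply/forall_inP => w; apply: H.
Qed.

End Graph.

(** * Exchanging a colour class and a block: the identity for sums over independent sets *)

Section TransferIdentity.
Local Open Scope ring_scope.
Variables (n : nat) (G : rel 'I_n).
Hypotheses (Gsym : symmetric G) (Girr : irreflexive G)
  (Gnui : natural_unit_interval G).
Variables (A : comNzRingType) (q : A).
Implicit Types (S T U D B W R : {set 'I_n}) (u v w : 'I_n).
Local Notation low := (lower_nbrs G).
Local Notation cross := (cross_inv G).

(** This is [c_B] for the block [B = x |: R] when [x] lies below [R]. It vanishes as soon as some
    vertex of [R] has no smaller neighbour in the block. *)
Definition block_weight (x : 'I_n) R : A :=
  \prod_(v in R) qnum q #|low (x |: R) v|.

Lemma lower_nbrs_addge B u v : (u <= v)%N -> low (v |: B) u = low B u.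
Proof. by move=> uv; rewrite lower_nbrsU lower_nbrs_ge // set0U. Qed.

Lemma block_weight_addmax x R v : v \notin R -> {in R, forall u, (u < v)%N} ->
  block_weight x (v |: R) = qnum q #|low (x |: R) v| * block_weight x R.
Proof.
move=> vR Rv; rewrite /block_weight big_setU1 //= setUCA lower_nbrs_addge //.
by congr (_ * _); apply: eq_bigr => u uR; rewrite lower_nbrs_addge // ltnW ?Rv.
Qed.

Variables (y z : A) (x : 'I_n).

(** On the left the colour class [S] is split off before the block [x |: R], on the right the block
    comes before [S]; only the crossing inversions differ. The power of [z] stands in for the factor
    Q of a block with [#|R|.+1] vertices. *)
Definition left_term S R : A :=
  y ^+ #|S| * q ^+ cross S (x |: R) * block_weight x R * z ^+ #|R|.
Definition right_term S R : A :=
  y ^+ #|S| * q ^+ cross (x |: R) S * block_weight x R * z ^+ #|R|.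
Definition split_sum (t : {set 'I_n} -> {set 'I_n} -> A) D U : A :=
  \sum_(S : {set 'I_n} | S \subset U)
    if indep G S && [disjoint S & D] then t S (U :\: S) else 0.

Section AddMax.
Variables (U : {set 'I_n}) (v : 'I_n).
Hypotheses (xU : x \notin U) (Uv : {in x |: U, forall u, (u < v)%N}).
Let N := low (x |: U) v.

Let Nadj u : u \in x |: U -> (u \in N) = G u v.
Proof. by move=> uU; rewrite inE uU Uv. Qed.

Let vU : v \notin U.
Proof. by apply/negP=> vU; have := Uv (setU1r x vU); rewrite ltnn. Qed.
Let v'x : v != x.
Proof. by apply/eqP=> e; have := Uv (setU11 x U); rewrite e ltnn. Qed.

Lemma upper_nbrs_clique : {in N &, forall a b, a != b -> G a b}.
Proof.
suff H a b : a \in N -> b \in N -> (a < b)%N -> G a b.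
  move=> a b aN bN; rewrite neq_ltn => /orP[] ab; first exact: H.
  by rewrite Gsym H.
by rewrite !inE => /and3P[_ _ av] /and3P[_ bv _] ab; have [] := Gnui ab bv av.
Qed.

Let indep_setU1 S : S \subset U -> indep G (v |: S) = indep G S && [disjoint S & N].
Proof.
move=> SU; apply/indepP/andP=> [H|[/indepP iS dis] a b].
  split; first by apply/indepP=> a b aS bS; apply: H; rewrite inE ?aS ?bS orbT.
  apply/pred0P=> a /=; apply/negP=> /andP[aS]; rewrite inE => /and3P[_ _ av].
  by have /negP := H a v (setU1r v aS) (setU11 v S).
have nG c : c \in S -> ~~ G c v.
  move=> cS; apply/negP=> cv; move/pred0P: dis => /(_ c) /=.
  by rewrite cS Nadj ?cv // setU1r // (subsetP SU).
move=> /setU1P[->|aS] /setU1P[->|bS]; first by rewrite Girr.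
- by rewrite Gsym nG.
- exact: nG.
- exact: iS.
Qed.

(** An independent set contains at most one vertex of the clique [N], so the boolean [~~
    [disjoint S & N]], read as a number, is the size of [S :&: N]. *)
Let meet S : S \subset U -> indep G S ->
  #|low (x |: (U :\: S)) v| = (#|N| - ~~ [disjoint S & N])%N
  /\ #|low S v| = ~~ [disjoint S & N].
Proof.
move=> SU iS.
have lowS : low S v = S :&: N.
  by apply/setP=> a; rewrite !inE; case: (boolP (a \in S)) => //= aS; rewrite (subsetP SU) ?orbT.
have cS : #|low S v| = ~~ [disjoint S & N].
  rewrite lowS -setI_eq0; apply/eqP; rewrite eqn_leq.
  case: (set_0Vmem (S :&: N)) => [->|[a aSN]]; first by rewrite eqxx cards0.
  have -> : S :&: N != set0 by apply/set0Pn; exists a.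
  rewrite card_gt0; apply/andP; split; last by apply/set0Pn; exists a.
  apply/card_le1P=> b bSN c; rewrite [RHS]inE; apply/idP/eqP=> [cSN|-> //].
  apply/eqP; apply: contraT => cb.
  move: bSN cSN; rewrite !(in_setI) => /andP[bS bN] /andP[cS cN].
  by move/indepP: iS => /(_ c b cS bS); rewrite upper_nbrs_clique.
split=> //.
rewrite -cS; apply/esym/(canLR (addnK _)).
rewrite -card_lower_nbrsU; last first.
  rewrite -setI_eq0; apply/eqP/setP=> a; rewrite !inE.
  case: eqP => [-> /=|_ /=]; last by case: (a \in S); rewrite ?andbF.
  by apply: contraNF xU => /(subsetP SU).
by rewrite -setUA [_ :\: _ :|: _]setUC -{1}(setIidPr SU) setID.
Qed.

Lemma left_term_addmax S : S \subset U -> indep G S ->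
  left_term S ((v |: U) :\: S) =
  left_term S (U :\: S) * z * qnum q (#|N| - ~~ [disjoint S & N]).
Proof.
move=> SU iS; have [mN mS] := meet SU iS.
have vS : v \notin S by apply: contra vU => /(subsetP SU).
have -> : (v |: U) :\: S = v |: (U :\: S).
  by rewrite setDUl; congr (_ :|: _); apply/setDidPl; rewrite disjoints1.
have vR : v \notin U :\: S by rewrite inE (negPf vU) andbF.
rewrite /left_term block_weight_addmax //; last first.
  by move=> u /setDP[uU _]; rewrite Uv // setU1r.
rewrite mN setUCA cross_invUr; last first.
  by rewrite disjoints1 !inE (negPf vU) andbF orbF.
rewrite cross_inv_ge; last by move=> u uS; rewrite ltnW // Uv // setU1r // (subsetP SU).
rewrite cardsU1 vR exprS add0n; ring.
Qed.

(** The last factor has no counterpart on the left: [v] exceeds all of [S], so it forms inversions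
    with [S] only when the block is listed before [S]. *)
Lemma right_term_addmax S : S \subset U -> indep G S ->
  right_term S ((v |: U) :\: S) =
  right_term S (U :\: S) * z * qnum q (#|N| - ~~ [disjoint S & N])
  * q ^+ (~~ [disjoint S & N]).
Proof.
move=> SU iS; have [mN mS] := meet SU iS.
have vS : v \notin S by apply: contra vU => /(subsetP SU).
have -> : (v |: U) :\: S = v |: (U :\: S).
  by rewrite setDUl; congr (_ :|: _); apply/setDidPl; rewrite disjoints1.
have vR : v \notin U :\: S by rewrite inE (negPf vU) andbF.
rewrite /right_term block_weight_addmax //; last first.
  by move=> u /setDP[uU _]; rewrite Uv // setU1r.
rewrite mN setUCA cross_invUl; last first.
  by rewrite disjoints1 !inE (negPf vU) andbF orbF.
rewrite cross_inv1 mS cardsU1 vR exprS exprD; ring.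
Qed.

Let low_disj S : S \subset U -> [disjoint S & N] -> low (x |: (U :\: S)) v = N.
Proof.
move=> SU dis; apply/setP=> a; rewrite !inE.
case: (boolP (a \in S)) => //= aS.
have/negPf := (disjointFr dis aS).
by rewrite !inE (subsetP SU) // orbT orbF /= => /negPf->; rewrite andbF.
Qed.

Lemma left_term_move S : S \subset U -> [disjoint S & N] ->
  left_term (v |: S) ((v |: U) :\: (v |: S)) =
  left_term S (U :\: S) * y * q ^+ #|N|.
Proof.
move=> SU dis; have vS : v \notin S by apply: contra vU => /(subsetP SU).
have -> : (v |: U) :\: (v |: S) = U :\: S.
  by rewrite -setDDl setU1K.
rewrite /left_term cross_invUl; last by rewrite disjoints1.
rewrite cross_inv1 low_disj // cardsU1 vS exprS exprD; ring.
Qed.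

Lemma right_term_move S : S \subset U -> [disjoint S & N] ->
  right_term (v |: S) ((v |: U) :\: (v |: S)) = right_term S (U :\: S) * y.
Proof.
move=> SU dis; have vS : v \notin S by apply: contra vU => /(subsetP SU).
have -> : (v |: U) :\: (v |: S) = U :\: S.
  by rewrite -setDDl setU1K.
rewrite /right_term cross_invUr; last by rewrite disjoints1.
rewrite cross_inv_ge ?cardsU1 ?vS ?exprS ?add0n; first by ring.
by move=> u /setU1P[->|/setDP[uU _]]; rewrite ltnW ?Uv ?setU11 // setU1r.
Qed.

Section SplitSums.
Variable D : {set 'I_n}.
Hypothesis DN : D \subset N.

Let disN S : [disjoint S & N] -> [disjoint S & D].
Proof. by move=> dis; rewrite disjoint_sym (disjointWl DN) // disjoint_sym. Qed.

(** Since [D] is contained in [N], the difference [split_sum t D U - split_sum t N U] runs over the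
    sets that avoid [D] but meet [N]. For these [v] has one smaller neighbour less in the block,
    hence a second coefficient [b]. *)
Let lin (t : {set 'I_n} -> {set 'I_n} -> A) a b :
  z * (a * split_sum t N U + b * (split_sum t D U - split_sum t N U)) =
  \sum_(S : {set 'I_n} | S \subset U)
     if indep G S then
       z * (a * (if [disjoint S & N] then t S (U :\: S) else 0)
         + b * ((if [disjoint S & D] then t S (U :\: S) else 0)
              - (if [disjoint S & N] then t S (U :\: S) else 0)))
     else 0.
Proof.
rewrite /split_sum -sumrB !big_distrr -big_split big_distrr /=.
by apply: eq_bigr => S SU; case: (indep G S) => //=; ring.
Qed.

Lemma left_sum_stay :
  \sum_(S : {set 'I_n} | S \subset U)
     (if indep G S && [disjoint S & D] then left_term S ((v |: U) :\: S) else 0) =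
  z * (qnum q #|N| * split_sum left_term N U +
       qnum q #|N|.-1 * (split_sum left_term D U - split_sum left_term N U)).
Proof.
rewrite lin; apply: eq_bigr => S SU; case iS: (indep G S) => //=.
rewrite left_term_addmax //.
case: (boolP [disjoint S & N]) => [/[dup] dis /disN ->|_]; first by rewrite subn0; ring.
by case: ifP => _; rewrite /= ?subn1; ring.
Qed.

Lemma right_sum_stay :
  \sum_(S : {set 'I_n} | S \subset U)
     (if indep G S && [disjoint S & D] then right_term S ((v |: U) :\: S) else 0) =
  z * (qnum q #|N| * split_sum right_term N U +
       q * qnum q #|N|.-1 * (split_sum right_term D U - split_sum right_term N U)).
Proof.
rewrite lin; apply: eq_bigr => S SU; case iS: (indep G S) => //=.
rewrite right_term_addmax //.
case: (boolP [disjoint S & N]) => [/[dup] dis /disN ->|_]; first by rewrite /= subn0 expr0; ring.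
by case: ifP => _; rewrite /= ?subn1 ?expr1; ring.
Qed.

Let addv (t : {set 'I_n} -> {set 'I_n} -> A) :
  split_sum t (v |: D) (v |: U) =
  \sum_(S : {set 'I_n} | S \subset U)
    (if indep G S && [disjoint S & D] then t S ((v |: U) :\: S) else 0).
Proof.
rewrite /split_sum sum_subset_setU1 // [X in _ + X]big1 ?addr0.
  apply: eq_bigr => S SU.
  have -> // : [disjoint S & v |: D] = [disjoint S & D].
  have vS : v \notin S by apply: contra vU => /(subsetP SU).
  by rewrite -!setI_eq0 setIUr (disjoint_setI0 _) ?set0U // disjoint_sym disjoints1.
move=> S SU; case: ifP => // /andP[_ /pred0P/(_ v)] /=.
by rewrite !setU11.
Qed.

Lemma left_sum_upper : split_sum left_term (v |: D) (v |: U) =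
  z * (qnum q #|N| * split_sum left_term N U +
       qnum q #|N|.-1 * (split_sum left_term D U - split_sum left_term N U)).
Proof. by rewrite addv left_sum_stay. Qed.

Lemma right_sum_upper : split_sum right_term (v |: D) (v |: U) =
  z * (qnum q #|N| * split_sum right_term N U +
       q * qnum q #|N|.-1 * (split_sum right_term D U - split_sum right_term N U)).
Proof. by rewrite addv right_sum_stay. Qed.

End SplitSums.

Let dis0 S : [disjoint S & set0] = true.
Proof. by rewrite -setI_eq0 setI0 eqxx. Qed.

(** The last summand collects the sets containing [v]. By independence their other elements avoid
    [N], and this is how restricted sums enter the induction. *)
Lemma left_sum_full : split_sum left_term set0 (v |: U) =
  z * (qnum q #|N| * split_sum left_term N U +
       qnum q #|N|.-1 * (split_sum left_term set0 U - split_sum left_term N U))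
  + y * q ^+ #|N| * split_sum left_term N U.
Proof.
rewrite {1}/split_sum sum_subset_setU1 // left_sum_stay ?sub0set //; congr (_ + _).
rewrite /split_sum big_distrr; apply: eq_bigr => S SU /=.
rewrite dis0 andbT indep_setU1 //; case: ifP => [/andP[iS dis]|_]; last by rewrite mulr0.
rewrite left_term_move //; ring.
Qed.

Lemma right_sum_full : split_sum right_term set0 (v |: U) =
  z * (qnum q #|N| * split_sum right_term N U +
       q * qnum q #|N|.-1 * (split_sum right_term set0 U - split_sum right_term N U))
  + y * split_sum right_term N U.
Proof.
rewrite {1}/split_sum sum_subset_setU1 // right_sum_stay ?sub0set //; congr (_ + _).
rewrite /split_sum big_distrr; apply: eq_bigr => S SU /=.
rewrite dis0 andbT indep_setU1 //; case: ifP => [/andP[iS dis]|_]; last by rewrite mulr0.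
rewrite right_term_move //; ring.
Qed.

End AddMax.

Definition upper_clique D B := [/\ D \subset B,
  {in D &, forall a b, a != b -> G a b} &
  forall a b, a \in D -> b \in B -> (a < b)%N -> b \in D].

(* [tau] is the common quotient of both sums by their linear factors; the last
   clause, for the clique of lower neighbours of the next vertex, is what makes
   the induction on [U] go through. *)
Theorem split_sum_transfer U : x \notin U -> {in U, forall u, (x < u)%N} ->
  exists tau : A,
  [/\ split_sum left_term set0 U =
        (z + q * y) * tau + y ^+ #|U| * (indep G (x |: U))%:R,
      split_sum right_term set0 U =
        (z + y) * tau + y ^+ #|U| * (indep G (x |: U))%:R &
      forall D, upper_clique D (x |: U) -> D != set0 ->
        q ^+ #|D|.-1 * split_sum left_term D U =
        split_sum right_term D U + (q ^+ #|D|.-1 - 1) * z * tau].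
Proof.
have [k] := ubnP #|U|; elim: k U => // k IHk U ltUk xU xltU.
have [->|[v0 v0U]] := set_0Vmem U.
  exists 0.
  have s0 D (t : {set 'I_n} -> {set 'I_n} -> A) : split_sum t D set0 = t set0 set0.
    rewrite /split_sum (eq_bigl (pred1 set0)); last by move=> S; rewrite subset0.
    rewrite big_pred1_eq set0D.
    have -> : indep G set0 by apply/indepP=> u w; rewrite inE.
    by rewrite -setI_eq0 set0I eqxx.
  have bw0 : block_weight x set0 = 1 by rewrite /block_weight big_set0.
  have ix : indep G (x |: set0).
    by apply/indepP=> u w; rewrite !inE !orbF => /eqP-> /eqP->; rewrite Girr.
  have lt0 : left_term set0 set0 = 1.
    by rewrite /left_term bw0 cards0 cross_inv0l !expr0 !mulr1.
  have rt0 : right_term set0 set0 = 1.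
    rewrite /right_term bw0 cards0 /cross_inv big1 ?expr0 ?mulr1 // => u _.
    by apply/eqP; rewrite cards_eq0; apply/eqP/setP=> w; rewrite !inE.
  split; rewrite ?s0 ?lt0 ?rt0 ?ix ?cards0 ?mulr0 ?add0r ?mulr1 //.
  move=> D [D1 _ _] D0; rewrite !s0 lt0 rt0.
  rewrite setU0 in D1; have -> : #|D|.-1 = 0%N.
    by have := subset_leq_card D1; rewrite cards1; case: #|D| => [|[]].
  by ring.
have [v vU vmax] := arg_maxnP (fun u : 'I_n => u : nat) v0U.
set U' := U :\ v; have defU : U = v |: U' by rewrite /U' setD1K.
have vU' : v \notin U' by rewrite !inE eqxx.
have xv : (x < v)%N by apply: xltU.
have U'v : {in x |: U', forall u, (u < v)%N}.
  move=> u /setU1P[-> //|]; rewrite !inE => /andP[uv uU].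
  by rewrite ltn_neqAle uv; apply: vmax.
have xU' : x \notin U' by rewrite !inE negb_and xU orbT.
have ltU'k : (#|U'| < k)%N by move: ltUk; rewrite defU cardsU1 vU'.
have xltU' : {in U', forall u, (x < u)%N} by move=> u /setD1P[_ /xltU].
have [tau [Lt Rt Dt]] := IHk U' ltU'k xU' xltU'.
have iU : indep G (x |: U) = indep G (x |: U') && (low (x |: U') v == set0).
  rewrite defU setUCA; apply/indepP/andP=> [H|[/indepP H /eqP N0] a b].
    split; first by apply/indepP=> a b aU bU; apply: H; rewrite inE ?aU ?bU orbT.
    apply/eqP/setP=> a; rewrite in_set0 inE; apply/negP=> /and3P[aU _ av].
    by have /negP := H a v (setU1r v aU) (setU11 v _).
  have nG c : c \in x |: U' -> ~~ G c v.
    move=> cU; apply/negP=> cv; move/setP: N0 => /(_ c).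
    by rewrite in_set0 inE cU cv U'v.
  move=> /setU1P[->|aS] /setU1P[->|bS]; first by rewrite Girr.
  - by rewrite Gsym nG.
  - exact: nG.
  - exact: H.
have cU : #|U| = #|U'|.+1 by rewrite defU cardsU1 vU'.
rewrite cU iU {iU}.
set N := low (x |: U') v; set i0 := y ^+ #|U'| * (indep G (x |: U'))%:R in Lt Rt.
have NU : N \subset x |: U' by apply/subsetP=> a; rewrite inE => /andP[].
have Ncl : {in N &, forall a b, a != b -> G a b} by apply: upper_nbrs_clique.
have Nup a b : a \in N -> b \in x |: U' -> (a < b)%N -> b \in N.
  move=> aN bU ab; move: aN; rewrite inE => /and3P[_ _ av].
  by rewrite inE bU U'v //=; have [] := Gnui ab (U'v _ bU) av.
have uN : upper_clique N (x |: U') by [].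
(* Being nonempty and closed upwards, [D] contains the largest vertex [v]; being a clique, it has
   its other vertices in [N]. *)
have splitD D : upper_clique D (x |: U) -> D != set0 ->
    exists D0, [/\ D = v |: D0, D0 \subset N, upper_clique D0 (x |: U') & #|D|.-1 = #|D0|].
  move=> [DU Dcl Dup] /set0Pn[a aD].
  have vD : v \in D.
    have := subsetP DU a aD; rewrite defU setUCA => /setU1P[<- //|aU'].
    exact: Dup aD (setU1r x vU) (U'v a aU').
  have D0U : D :\ v \subset x |: U'.
    apply/subsetP=> b /setD1P[bv bD].
    by have := subsetP DU b bD; rewrite defU setUCA => /setU1P[bv'|//]; rewrite bv' eqxx in bv.
  exists (D :\ v); rewrite setD1K //; split=> //.
  - apply/subsetP=> b bD; rewrite inE (subsetP D0U) // U'v ?(subsetP D0U) //=.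
    by move/setD1P: bD => [bv bD]; apply: Dcl.
  - split=> // [b c /setD1P[_ bD] /setD1P[_ cD]|b c /setD1P[_ bD] cU' bc]; first exact: Dcl.
    apply/setD1P; split; first by rewrite neq_ltn U'v.
    by apply: Dup bD _ bc; rewrite defU setUCA setU1r.
  - by rewrite (cardsD1 v D) vD.
case: (posnP #|N|) => [N0|Npos].
  move/eqP: N0; rewrite cards_eq0 => /eqP N0.
  (* A block containing [v] has weight 0 here, so [v] must join [S] and both full sums are
     multiplied by [y]. *)
  exists (y * tau); rewrite defU (left_sum_full xU' U'v) (right_sum_full xU' U'v) -/N N0.
  rewrite cards0 eqxx andbT qnum0 Lt Rt.
  have -> : y ^+ #|U'|.+1 * (indep G (x |: U'))%:R = y * i0 by rewrite exprS mulrA.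
  split; [by rewrite expr0; ring | by ring |].
  move=> D; rewrite -defU => /splitD-DU D0.
  have [D1 [-> D1N _ ->]] := DU D0.
  rewrite defU (left_sum_upper xU' U'v) -/N // (right_sum_upper xU' U'v) -/N //.
  move: D1N; rewrite N0 subset0 => /eqP->; rewrite cards0 qnum0 expr0; ring.
have N0 : N != set0 by rewrite -card_gt0.
have DN := Dt N uN N0.
set c := qnum q #|N|.-1; set P := q ^+ #|N|.-1 in DN.
have qN : qnum q #|N| = c + P by rewrite -[in LHS](prednK Npos) qnumSr.
have PE : P = 1 + (q - 1) * c by rewrite /P qnum_geom.
have qP : q ^+ #|N| = q * P by rewrite -[in LHS](prednK Npos) exprS.
(* If [x |: U'] is independent, the clique [N] has a single vertex and [c] is 0. This removes the
   inhomogeneous terms. *)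
have ci0 : c * i0 = 0.
  rewrite /i0; case: (boolP (indep _ _)) => [/indepP iU|_]; last by rewrite !mulr0.
  suff -> : c = 0 by rewrite mul0r.
  suff N1 : #|N|.-1 = 0%N by rewrite /c N1 qnum0.
  suff : (#|N| <= 1)%N by case: #|N| => [|[]].
  have [a aN] := set0Pn _ N0.
  apply/card_le1P=> a' a'N b; rewrite [RHS]inE; apply/idP/eqP=> [bN|-> //].
  apply/eqP; apply: contraT => ba.
  have /negP := iU b a' (subsetP NU b bN) (subsetP NU a' a'N); case.
  exact: Ncl.
(* The quotient is read off from the right sum: by [PE], [c + P - q * c = 1], so the restricted sum
   over [N] gets the coefficient [z + y]. On the left sum [DN] is needed to trade the left
   restricted sum for the right one. *)
exists (split_sum right_term N U' + z * q * c * tau).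
rewrite defU (left_sum_full xU' U'v) (right_sum_full xU' U'v) -/N (negPf N0) andbF.
rewrite mulr0 addr0 qN qP Lt Rt -/c; split.
- set L := split_sum _ N U'; set R := split_sum _ N U'.
  transitivity ((z + q * y) * (P * L) + z * c * ((z + q * y) * tau) + z * (c * i0)); first by ring.
  rewrite DN -/R ci0 PE; ring.
- set R := split_sum _ N U'.
  transitivity ((z + y) * R + (P - 1 + c - q * c) * z * R
     + z * q * c * (z + y) * tau + z * q * (c * i0)); first by ring.
  rewrite ci0 PE; ring.
move=> D; rewrite -defU => /splitD-DU D0.
have [D1 [-> D1N uD1 ->]] := DU D0.
rewrite defU (left_sum_upper xU' U'v) -/N // (right_sum_upper xU' U'v) -/N //.
rewrite qN -/c.
(* For [D = [set v]] nothing is left of the clique, and the formulas for the full sums take the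
   place of the clique relation. *)
have [D10|D1n0] := eqVneq D1 set0.
  rewrite D10 cards0 expr0 Lt Rt.
  set L := split_sum _ N U'; set R := split_sum _ N U'.
  transitivity (z * (P * L + c * ((z + q * y) * tau) + c * i0)); first by ring.
  rewrite DN ci0 -/R.
  transitivity (z * ((c + P - q * c) * R + q * c * ((z + y) * tau) + q * (c * i0))); last by ring.
  rewrite ci0 PE; ring.
have D1D := Dt D1 uD1 D1n0.
have D1E : q ^+ #|D1| = q * q ^+ #|D1|.-1.
  by rewrite -[in LHS](prednK (n := #|D1|)) ?exprS // card_gt0.
rewrite D1E; move: D1D.
set L := split_sum _ N U'; set R := split_sum _ N U'.
set L1 := split_sum _ D1 U'; set R1 := split_sum _ D1 U'.
set e := q ^+ _ => D1D.
transitivity (z * (q * e * (P * L) + c * (q * (e * L1)))); first by ring.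
rewrite DN D1D -/R PE; ring.
Qed.
End TransferIdentity.

(** * The block recursion and its behaviour when a colour is added *)

Section BlockRecursion.
Local Open Scope ring_scope.
Variables (n : nat) (G : rel 'I_n).
Hypotheses (Gsym : symmetric G) (Girr : irreflexive G)
  (Gnui : natural_unit_interval G).
Variables (A : comNzRingType) (q : A).
Implicit Types (S T U D B W R M : {set 'I_n}) (u v w x : 'I_n).
Local Notation cross := (cross_inv G).
Local Notation bw := (block_weight G q).

Definition block_rec (Q : nat -> A) (X : {set 'I_n} -> A) : Prop :=
  X set0 = 1 /\
  forall x W, x \notin W -> {in W, forall u, (x < u)%N} ->
    X (x |: W) = \sum_(R : {set 'I_n} | R \subset W)
      bw x R * Q #|R|.+1 * q ^+ cross (x |: R) (W :\: R) * X (W :\: R).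

Lemma block_rec_unique Q X1 X2 : block_rec Q X1 -> block_rec Q X2 -> X1 =1 X2.
Proof.
move=> [X10 X1r] [X20 X2r] W.
have [k] := ubnP #|W|; elim: k W => // k IHk W ltWk.
have [->|[v0 v0W]] := set_0Vmem W; first by rewrite X10 X20.
have [x xW xmin] := arg_minnP (fun u : 'I_n => u : nat) v0W.
rewrite -(setD1K xW) in ltWk *.
have xW' : x \notin W :\ x by rewrite !inE eqxx.
have ltxW : {in W :\ x, forall u, (x < u)%N}.
  by move=> u /setD1P[ux uW]; rewrite ltn_neqAle eq_sym ux; apply: xmin.
rewrite X1r // X2r //; apply: eq_bigr => R RW; congr (_ * _); apply: IHk.
move: ltWk; rewrite cardsU1 xW' add1n ltnS; apply: leq_ltn_trans.
by rewrite subset_leq_card ?subsetDl.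
Qed.

Variables (y : A) (Q Q' : nat -> A).
Hypotheses (Q'1 : Q' 1%N = Q 1%N + y)
  (Q'S : forall k, Q' k.+2 + y * Q' k.+1 = Q k.+2 + q * y * Q k.+1).

(** The linear functional sending ['X^k] to [P k.+1]; the shift is there because [z] marks the
    vertices of a block other than its minimum. The cut-off [N] is chosen above the degrees that
    occur. *)
Definition peval (N : nat) (P : nat -> A) (p : {poly A}) : A :=
  \sum_(k < N) p`_k * P k.+1.

Lemma pevalD N P p1 p2 : peval N P (p1 + p2) = peval N P p1 + peval N P p2.
Proof.
by rewrite /peval -big_split; apply: eq_bigr => k _; rewrite coefD mulrDl.
Qed.

Lemma peval_sum N P (I : finType) (C : pred I) (p : I -> {poly A}) :
  peval N P (\sum_(i | C i) p i) = \sum_(i | C i) peval N P (p i).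
Proof.
apply: (big_morph _ (@pevalD N P)).
by rewrite /peval big1 // => k _; rewrite coef0 mul0r.
Qed.

Lemma peval_monomial N P c k : (k < N)%N ->
  peval N P (c%:P * 'X^k) = c * P k.+1.
Proof.
move=> kN; rewrite /peval (bigD1 (Ordinal kN)) //= big1 ?addr0.
  by rewrite coefCM coefXn eqxx mulr1.
move=> i ik; rewrite coefCM coefXn.
by have /negPf-> : (i : nat) != k by []; rewrite mulr0 mul0r.
Qed.

(** The bound is strict because ['X] pushes the coefficient of index [N.-1] past the cut-off, so
    that this coefficient has to vanish. *)
Lemma pevalXM N P c (p : {poly A}) : (size p < N)%N ->
  peval N P (('X + c%:P) * p) = \sum_(k < N) p`_k * (P k.+2 + c * P k.+1).
Proof.
move=> pN; have NK := prednK (leq_ltn_trans (leq0n _) pN).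
rewrite mulrDl pevalD.
have -> : peval N P ('X * p) = \sum_(k < N) p`_k * P k.+2.
  rewrite /peval -NK big_ord_recl coefXM eqxx mul0r add0r big_ord_recr /=.
  rewrite [p`_N.-1]nth_default ?mul0r ?addr0; last by rewrite -ltnS NK.
  by apply: eq_bigr => k _; rewrite coefXM.
rewrite /peval -big_split; apply: eq_bigr => k _.
rewrite coefCM /=; ring.
Qed.

Lemma qnumC k : qnum q%:P k = (qnum q k)%:P.
Proof. by rewrite /qnum rmorph_sum; apply: eq_bigr => i _; rewrite rmorphXn. Qed.

Lemma block_weightC x R : block_weight G q%:P x R = (bw x R)%:P.
Proof. by rewrite /block_weight rmorph_prod; apply: eq_bigr => v _; rewrite qnumC. Qed.

(** [split_sum_transfer] is used over [{poly A}] with [z = 'X], and then [peval] with [Q] on the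
    left and [Q'] on the right. By [Q'S] the multiples of [tau] get equal values. The constant terms
    are multiplied by [Q 1] and [Q' 1], whose difference [y] yields the extra term on the left. *)
Lemma split_sum_change x U : x \notin U -> {in U, forall u, (x < u)%N} ->
  \sum_(S : {set 'I_n} | S \subset U) (if indep G S then
     y ^+ #|S| * q ^+ cross S (x |: (U :\: S)) * bw x (U :\: S) * Q #|U :\: S|.+1
     else 0) + y ^+ #|U|.+1 * (indep G (x |: U))%:R =
  \sum_(S : {set 'I_n} | S \subset U) (if indep G S then
     y ^+ #|S| * q ^+ cross (x |: (U :\: S)) S * bw x (U :\: S) * Q' #|U :\: S|.+1
     else 0).
Proof.
move=> xU ltxU.
have [tau [Lt Rt _]] :=
  split_sum_transfer Gsym Girr Gnui q%:P y%:P 'X xU ltxU.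
pose N := (maxn (size tau) #|U|).+1.
have sN : (size tau < N)%N by rewrite ltnS leq_maxl.
have UN S : (#|U :\: S| < N)%N.
  by rewrite ltnS (leq_trans _ (leq_maxr _ _)) // subset_leq_card ?subsetDl.
set i0 := (indep G (x |: U))%:R.
have iC : y%:P ^+ #|U| * (indep G (x |: U))%:R = (y ^+ #|U| * i0)%:P * 'X^0 :> {poly A}.
  by rewrite expr0 mulr1 polyCM rmorphXn /= /i0; case: (indep _ _).
have Le : peval N Q (split_sum G (left_term G q%:P y%:P 'X x) set0 U) =
   \sum_(S : {set 'I_n} | S \subset U) (if indep G S then
     y ^+ #|S| * q ^+ cross S (x |: (U :\: S)) * bw x (U :\: S) * Q #|U :\: S|.+1
     else 0).
  rewrite /split_sum peval_sum; apply: eq_bigr => S SU.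
  rewrite -setI_eq0 setI0 eqxx andbT; case: ifP => _; last first.
    by rewrite /peval big1 // => k _; rewrite coef0 mul0r.
  by rewrite /left_term block_weightC -!rmorphXn -!rmorphM /= peval_monomial.
have Re : peval N Q' (split_sum G (right_term G q%:P y%:P 'X x) set0 U) =
   \sum_(S : {set 'I_n} | S \subset U) (if indep G S then
     y ^+ #|S| * q ^+ cross (x |: (U :\: S)) S * bw x (U :\: S) * Q' #|U :\: S|.+1
     else 0).
  rewrite /split_sum peval_sum; apply: eq_bigr => S SU.
  rewrite -setI_eq0 setI0 eqxx andbT; case: ifP => _; last first.
    by rewrite /peval big1 // => k _; rewrite coef0 mul0r.
  by rewrite /right_term block_weightC -!rmorphXn -!rmorphM /= peval_monomial.
rewrite -Le -Re Lt Rt iC !pevalD !peval_monomial // -polyCM !pevalXM //.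
rewrite Q'1 (eq_bigr (fun k : 'I_N => tau`_k * (Q' k.+2 + y * Q' k.+1))); last first.
  by move=> k _; rewrite Q'S.
rewrite exprS; ring.
Qed.

Lemma sum_subset_pairs W (f : {set 'I_n} -> {set 'I_n} -> A) :
  \sum_(S : {set 'I_n} | S \subset W) \sum_(R : {set 'I_n} | R \subset W :\: S) f S R =
  \sum_(U : {set 'I_n} | U \subset W) \sum_(S : {set 'I_n} | S \subset U) f S (U :\: S).
Proof.
rewrite [RHS](exchange_big_dep (fun S => S \subset W)) /=; last first.
  by move=> U S UW SU; apply: subset_trans UW.
apply: eq_bigr => S SW.
rewrite [RHS](reindex_onto (fun R => S :|: R) (fun U => U :\: S)) /=; last first.
  by move=> U /andP[_ SU]; rewrite -{1}(setIidPr SU) setID.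
have DE R : [disjoint R & S] -> (S :|: R) :\: S = R.
  by move=> dis; rewrite setDUl setDv set0U; apply/setDidPl.
apply: eq_big => [R|R].
  rewrite subUset SW subsetUl andbT subsetD /=; apply: andb_id2l => _.
  apply/idP/eqP => [/DE //|<-].
  by rewrite -setI_eq0 setIDAC setDIl setDv setI0.
by rewrite subsetD => /andP[_ /DE->].
Qed.

Lemma sum_subset_compl U (f : {set 'I_n} -> {set 'I_n} -> A) :
  \sum_(R : {set 'I_n} | R \subset U) f R (U :\: R) =
  \sum_(S : {set 'I_n} | S \subset U) f (U :\: S) S.
Proof.
rewrite (reindex_onto (fun S => U :\: S) (fun S => U :\: S)) /=; last first.
  by move=> R RU; rewrite setDDr setDv set0U; apply/setIidPr.
apply: eq_big => [S|S /andP[_ /eqP->]] //.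
by rewrite subsetDl /= setDDr setDv set0U; apply/eqP/setIidPr.
Qed.

(* Peeling off the colour class [S] of the largest colour. *)
Theorem block_rec_step X X' : block_rec Q X ->
  (forall W, X' W = \sum_(S : {set 'I_n} | S \subset W)
     if indep G S then y ^+ #|S| * q ^+ cross S (W :\: S) * X (W :\: S) else 0) ->
  block_rec Q' X'.
Proof.
move=> [X0 Xr] X'E; split.
  rewrite X'E (eq_bigl (pred1 set0)); last by move=> S; rewrite subset0.
  rewrite big_pred1_eq setD0 X0 cards0 cross_inv0l !expr0 !mulr1.
  by have -> : indep G set0 by apply/indepP=> u w; rewrite inE.
move=> x W xW ltxW.
have sub U : U \subset W -> x \notin U /\ {in U, forall u, (x < u)%N}.
  by move=> /subsetP UW; split=> [|u /UW /ltxW //]; apply: contra xW => /UW.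
(* Either [x] lies outside the colour class, and its block is peeled off next, or [x] belongs to the
   class. *)
rewrite X'E sum_subset_setU1 //.
pose main S R := if indep G S then
     y ^+ #|S| * q ^+ cross S (x |: R) * bw x R * Q #|R|.+1 else 0.
pose main' S R := if indep G S then
     y ^+ #|S| * q ^+ cross (x |: R) S * bw x R * Q' #|R|.+1 else 0.
pose tail U := q ^+ cross (x |: U) (W :\: U) * X (W :\: U).
have disD S U : [disjoint S & U :\: S].
  by rewrite disjoint_sym -setI_eq0 setIDAC setDIl setDv setI0.
have glue U S : S \subset U -> S :|: (U :\: S) = U.
  by move=> SU; rewrite -{1}(setIidPr SU) setID.
have disW U S : S \subset U -> [disjoint S & W :\: U].
  by move=> SU; rewrite disjoint_sym (disjointWr SU) // disjoint_sym disD.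
(* Here [U] is what the colour class and the block remove from [W]. The remaining vertices enter
   only through [tail U], so the two sides can be compared for each [U] separately. *)
transitivity (\sum_(U : {set 'I_n} | U \subset W)
   (\sum_(S : {set 'I_n} | S \subset U) main S (U :\: S)
    + y ^+ #|U|.+1 * (indep G (x |: U))%:R) * tail U).
  under [RHS]eq_bigr do rewrite mulrDl.
  rewrite big_split /=; congr (_ + _); last first.
    apply: eq_bigr => S SW; have [xS _] := sub S SW.
    rewrite cardsU1 xS add1n /tail.
    have -> : (x |: W) :\: (x |: S) = W :\: S by rewrite -setDDl setU1K.
    by case: ifP => _; rewrite ?mulr1 ?mulr0 ?mul0r // mulrA.
  under [RHS]eq_bigr do rewrite big_distrl /=.
  transitivity (\sum_(S : {set 'I_n} | S \subset W)
    \sum_(R : {set 'I_n} | R \subset W :\: S) main S R * tail (S :|: R)); last first.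
    rewrite sum_subset_pairs; apply: eq_bigr => U UW; apply: eq_bigr => S SU.
    by rewrite glue.
  apply: eq_bigr => S SW; have [xS ltxS] := sub S SW.
  rewrite /main; case: ifP => _; last by rewrite big1 // => R _; rewrite mul0r.
  have -> : (x |: W) :\: S = x |: (W :\: S).
    by rewrite setDUl; congr (_ :|: _); apply/setDidPl; rewrite disjoints1.
  have [xWS ltxWS] := sub _ (subsetDl W S).
  rewrite Xr // big_distrr; apply: eq_bigr => R RWS /=.
  rewrite /tail -setDDl -[in cross S _](glue _ _ RWS) setUA cross_invUr; last first.
    rewrite -setI_eq0 setIUl setU_eq0 !setI_eq0 disD andbT.
    by rewrite disjoints1 !inE (negPf xW) !andbF.
  rewrite setUCA [cross (S :|: _) _]cross_invUl; last first.
    rewrite disjoint_sym -setI_eq0 setIUl setU_eq0 !setI_eq0.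
    rewrite disjoints1 xS /= disjoint_sym.
    by move: RWS; rewrite subsetD => /andP[_]; rewrite disjoint_sym.
  rewrite !exprD; ring.
transitivity (\sum_(U : {set 'I_n} | U \subset W)
   \sum_(S : {set 'I_n} | S \subset U) main' S (U :\: S) * tail U).
  apply: eq_bigr => U UW; have [xU ltxU] := sub U UW.
  by rewrite -big_distrl /= /main split_sum_change.
transitivity (\sum_(R : {set 'I_n} | R \subset W)
    \sum_(S : {set 'I_n} | S \subset W :\: R) main' S R * tail (R :|: S)).
  rewrite sum_subset_pairs; apply: eq_bigr => U UW.
  rewrite (sum_subset_compl U (fun R S => main' R S * tail U)).
  by apply: eq_bigr => S SU; rewrite glue.
apply: eq_bigr => R RW; rewrite X'E big_distrr; apply: eq_bigr => S SWR /=.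
rewrite /main'; case: ifP => _; last by rewrite mulr0 mul0r.
rewrite /tail -setDDl -[in cross (x |: R) (W :\: R)](glue _ _ SWR) cross_invUr ?disD //.
have [xS _] := sub S (subset_trans SWR (subsetDl _ _)).
rewrite setUA [cross (_ :|: S) _]cross_invUl; last first.
  rewrite -setI_eq0 setIUl setU_eq0 !setI_eq0 disjoints1 xS /=.
  by move: SWR; rewrite subsetD => /andP[_]; rewrite disjoint_sym.
rewrite !exprD; ring.
Qed.

End BlockRecursion.

(** * Sums over bounded sequences, split at the first or the last entry *)

Section BoundedSeqSums.
Local Open Scope ring_scope.
Variables (A : nmodType) (T : finType).

Lemma big_bseq_cons m (f : seq T -> A) :
  \sum_(F : {bseq m.+1 of T}) f F =
  f [::] + \sum_(t : T) \sum_(F : {bseq m of T}) f (t :: F).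
Proof.
transitivity (\sum_(s <- [::] :: [seq t :: val F | t <- enum T, F <- enum {bseq m of T}]) f s).
  rewrite -(big_map val predT f) /=; apply: perm_big; apply: uniq_perm.
  - by rewrite map_inj_uniq ?index_enum_uniq //; apply: val_inj.
  - rewrite cons_uniq allpairs_uniq ?enum_uniq ?andbT //.
      by apply/allpairsPdep=> -[t [F []]].
    by move=> [t1 F1] [t2 F2] _ _ [-> /val_inj ->].
  move=> s; rewrite inE; apply/mapP/predU1P => [[F _ ->]|].
    case: F => -[|t s'] /= sz; [by left | right].
    apply/allpairsPdep; exists t, (@Bseq m T s' sz).
    by rewrite !mem_enum.
  case=> [->|/allpairsPdep[t [F [_ _ ->]]]].
    by exists [bseq]; rewrite ?mem_index_enum.
  have sz : (size (t :: val F) <= m.+1)%N by rewrite /= ltnS size_bseq.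
  by exists (Bseq sz); rewrite ?mem_index_enum.
rewrite big_cons big_allpairs_dep big_enum; congr (_ + _).
by apply: eq_bigr => t _; rewrite big_enum.
Qed.

Lemma big_bseq_rcons m (f : seq T -> A) :
  \sum_(F : {bseq m.+1 of T}) f F =
  f [::] + \sum_(t : T) \sum_(F : {bseq m of T}) f (rcons F t).
Proof.
transitivity (\sum_(F : {bseq m.+1 of T}) f (rev F)).
  have szr l (F : {bseq l of T}) : (size (rev F) <= l)%N by rewrite size_rev size_bseq.
  rewrite (reindex (fun F : {bseq m.+1 of T} => Bseq (szr _ F))) //=.
  by exists (fun F => Bseq (szr _ F)) => F _; apply: val_inj; rewrite /= revK.
rewrite (big_bseq_cons m (fun s => f (rev s))); congr (_ + _).
apply: eq_bigr => t _.
have szr l (F : {bseq l of T}) : (size (rev F) <= l)%N by rewrite size_rev size_bseq.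
rewrite (reindex (fun F : {bseq m of T} => Bseq (szr _ F))) /=.
  by apply: eq_bigr => F _; rewrite rev_cons revK.
by exists (fun F => Bseq (szr _ F)) => F _; apply: val_inj; rewrite /= revK.
Qed.

Lemma big_bseq0 (f : seq T -> A) : \sum_(F : {bseq 0 of T}) f F = f [::].
Proof.
rewrite (big_pred1 [bseq]) // => F; apply/esym/eqP; apply: val_inj => /=.
by case: F => -[].
Qed.

End BoundedSeqSums.

(** * The alternating sums Q_k over compositions *)

Section CompositionSums.
Local Open Scope ring_scope.
Variables (A : comNzRingType) (q : A).
Implicit Types (e f g : nat -> A).

Definition is_comp (k : nat) (s : seq nat) : bool := all (leq 1) s && (sumn s == k).

Definition comp_term e (k : nat) (s : seq nat) : A :=
  if is_comp k s then
    (-1) ^+ (size s).-1 * qnum q (head 0%N s) * \prod_(a <- s) e a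
  else 0.

(** [l] bounds the number of parts and [m] their size; from [k] on the value is constant. *)
Definition comp_sum e (l m k : nat) : A :=
  \sum_(s : {bseq l of 'I_m.+1}) comp_term e k (map val s).

(** The empty sequence is a composition of 0, but its head defaults to 0 and [qnum 0 = 0]. Thus Q_0
    is 0. *)
Lemma comp_term_nil e k : comp_term e k [::] = 0.
Proof. by rewrite /comp_term /= qnum0 mulr0 mul0r if_same. Qed.

(** The last part is stripped, since the first one carries the factor [qnum]. Stripping flips the
    sign, except that a single part forms a term of its own. *)
Lemma comp_term_rcons e k s a : comp_term e k (rcons s a) =
  (if nilp s && (a == k) then qnum q k * e k else 0)
  - (if (0 < a <= k)%N then e a * comp_term e (k - a) s else 0).
Proof.
rewrite [LHS]/comp_term /is_comp all_rcons sumn_rcons big_rcons.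
case: s => [|b s].
  rewrite comp_term_nil mulr0 if_same subr0 /= andbT add0n big_nil.
  case: (a =P k) => [->|_]; last by rewrite andbF.
  rewrite andbT expr0 !mul1r; case: k => [|k] //=.
  by rewrite qnum0 mul0r.
rewrite /= sub0r /comp_term /is_comp /= size_rcons.
case: (posnP a) => a0 /=; first by rewrite oppr0.
case: (leqP a k) => ak /=; last first.
  rewrite oppr0; case: ifP => // /andP[_ /eqP E].
  by move: ak; rewrite -E ltnNge leq_addl.
rewrite -[in LHS](subnK ak) eqn_add2r.
by case: ifP => _; rewrite ?mulr0 ?oppr0 // exprS; ring.
Qed.

Lemma comp_sumS e l m k : (k <= m)%N ->
  comp_sum e l.+1 m k =
  qnum q k * e k - \sum_(a < k) e a.+1 * comp_sum e l m (k - a.+1).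
Proof.
move=> km; rewrite /comp_sum (big_bseq_rcons _ (fun s => comp_term e k (map val s))).
rewrite comp_term_nil add0r.
have split (a : 'I_m.+1) : \sum_(F : {bseq l of 'I_m.+1}) comp_term e k (map val (rcons F a)) =
   (if a == k :> nat then qnum q k * e k else 0)
   - (if (0 < a <= k)%N then e a * comp_sum e l m (k - a) else 0).
  under eq_bigr do rewrite map_rcons comp_term_rcons.
  rewrite sumrB; congr (_ - _); last first.
    by case: ifP => _; [rewrite -big_distrr | rewrite big1].
  case: eqP => _; last by rewrite big1 // => F _; rewrite andbF.
  rewrite -big_mkcond /= (big_pred1 [bseq]) // => F; rewrite andbT.
  apply/nilP/eqP => [|->//]; case: F => -[|? ?] //= i _; exact: val_inj.
under eq_bigr do rewrite split.
rewrite sumrB; congr (_ - _).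
  by rewrite -big_mkcond (big_pred1 (inord k)) // => a; apply/eqP/eqP => [<-|->]; rewrite ?inord_val ?inordK.
rewrite -(big_mkord xpredT (fun a : nat => if (0 < a <= k)%N then e a * comp_sum e l m (k - a) else 0)).
rewrite big_ltn // add0r (big_cat_nat _ (n := k.+1)) //= [X in _ + X]big1_seq ?addr0.
  rewrite big_add1 /= big_mkord; apply: eq_bigr => a _.
  by rewrite ltn_ord.
move=> a; rewrite mem_index_iota => /and3P[_ ka _].
by rewrite [(a <= k)%N]leqNgt ka andbF.
Qed.

Lemma comp_sum0 e l m : comp_sum e l m 0 = 0.
Proof.
case: l => [|l]; last by rewrite comp_sumS // big_ord0 qnum0 mul0r subr0.
by rewrite /comp_sum (big_bseq0 (fun s => comp_term e 0 (map val s))) comp_term_nil.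
Qed.

Lemma comp_sum_stable e k l m l' m' :
  (k <= l)%N -> (k <= m)%N -> (k <= l')%N -> (k <= m')%N ->
  comp_sum e l m k = comp_sum e l' m' k.
Proof.
elim/ltn_ind: k l l' => -[|k] IHk [|l] [|l'] // kl km kl' km'; rewrite ?comp_sum0 //.
rewrite !comp_sumS //; congr (_ - _); apply: eq_bigr => a _; congr (_ * _).
by apply: IHk; lia.
Qed.

Definition csum e k : A := comp_sum e k k k.

Lemma csumE e l m k : (k <= l)%N -> (k <= m)%N -> comp_sum e l m k = csum e k.
Proof. by move=> kl km; apply: comp_sum_stable. Qed.

Definition conv f g k : A := \sum_(j < k.+1) f j * g (k - j)%N.

Lemma conv_csum e k : e 0%N = 1 -> conv e (csum e) k = qnum q k * e k.
Proof.
move=> e0; rewrite /conv big_ord_recl e0 mul1r subn0.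
case: k => [|k]; first by rewrite big_ord0 /csum comp_sum0 qnum0 mul0r addr0.
rewrite {1}/csum comp_sumS //; apply/eqP; rewrite -addrA addrC -subr_eq0 addrK addrC subr_eq0.
apply/eqP; apply: eq_bigr => a _; congr (_ * _); rewrite csumE //; lia.
Qed.

(* Adjoining a variable [y] multiplies the generating series of [e] by
   [1 + y t]; the generating series of [csum e] is the quotient of the
   series with coefficients [qnum k * e k] by that of [e]. *)
Theorem csum_adjoin e e' y : e 0%N = 1 -> e' 0%N = 1 ->
  (forall k, e' k.+1 = e k.+1 + y * e k) ->
  csum e' 1 = csum e 1 + y /\
  forall k, csum e' k.+2 + y * csum e' k.+1 = csum e k.+2 + q * y * csum e k.+1.
Proof.
move=> e0 e'0 e'S.
(* [D k] is the coefficient of t^(k+1) in (1 + y t) Q'(t) - (1 + q y t) Q(t) - y t. Its convolution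
   with [e] is 0, and as [e 0 = 1] this forces [D] to vanish, with no division by 1 - q. *)
pose D k := csum e' k.+1 + y * csum e' k - (csum e k.+1 + q * y * csum e k)
            - (if k == 0%N then y else 0).
have q0 f : csum f 0 = 0 by rewrite /csum comp_sum0.
have convS f g k : conv f g k.+1 = f k.+1 * g 0%N + \sum_(j < k.+1) f j * g (k - j).+1.
  rewrite /conv big_ord_recr subnn addrC; congr (_ + _).
  by apply: eq_bigr => j _ /=; rewrite subSn // -ltnS.
have conv' k : conv e' (csum e') k.+1 = conv e (csum e') k.+1 + y * conv e (csum e') k.
  rewrite /conv big_ord_recl [in RHS]big_ord_recl e0 e'0 -addrA; congr (_ + _).
  rewrite big_distrr -big_split; apply: eq_bigr => j _ /=.
  by rewrite e'S subSS; ring.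
have convD k : conv e D k = 0.
  have -> : conv e D k = (conv e (csum e') k.+1 + y * conv e (csum e') k)
     - (conv e (csum e) k.+1 + q * y * conv e (csum e) k) - y * e k.
    rewrite !convS !q0 !mulr0 !add0r.
    have -> : y * e k = \sum_(j < k.+1) e j * (if (k - j)%N == 0%N then y else 0).
      rewrite [RHS]big_ord_recr /= subnn /= [RHS]addrC mulrC.
      by rewrite [X in _ + X]big1 ?addr0 // => j _; rewrite subn_eq0 leqNgt ltn_ord mulr0.
    rewrite /conv !big_distrr -!big_split -!sumrB /=; apply: eq_bigr => j _.
    by rewrite /D; move: (if _ then _ else _) (csum _ _) (csum _ _) (csum _ _) (csum _ _) => *; ring.
  rewrite -conv' !conv_csum // e'S qnumS; ring.
have D0 k : D k = 0.
  elim/ltn_ind: k => k IHk; have := convD k.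
  rewrite /conv big_ord_recl e0 mul1r subn0 big1 ?addr0 // => j _.
  by rewrite IHk ?mulr0 //= /bump leq0n; have := ltn_ord j; lia.
split=> [|k].
  by have /eqP := D0 0%N; rewrite /D eqxx !q0 !mulr0 !addr0 -addrA -opprD subr_eq0 => /eqP.
by have /eqP := D0 k.+1; rewrite /D /= subr0 subr_eq0 => /eqP.
Qed.

End CompositionSums.

(** * Good sequences, generated by inserting the largest vertex *)

Section GoodSequences.
Local Open Scope nat_scope.
Variables (n : nat) (G : rel 'I_n).
Hypotheses (Gsym : symmetric G) (Girr : irreflexive G)
  (Gnui : natural_unit_interval G).
Implicit Types (u v w x : 'I_n) (p s t vs : seq 'I_n).

(* Sequences of vertices are stored with the most recently read vertex first. *)
Fixpoint good x p : bool :=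
  if p is b :: p' then
    if p' is c :: _ then
      [&& good x p', b \notin p', has (G b) p' & (b < c) ==> G b c]
    else b == x
  else false.

Fixpoint rinv p : nat :=
  if p is b :: p' then rinv p' + count (fun a : 'I_n => (b < a) && G a b) p' else 0.

(** Meant for [v] larger than all of [p]. In reading order, [v] may come right before [b] only if
    the descent from [v] to [b] is an edge and [v] has a neighbour read earlier. Reading [v] last is
    the extra case in [insertions]. *)
Fixpoint insert_in v p : seq (seq 'I_n) :=
  if p is b :: p' then
    (if G v b && has (G v) p' then [:: b :: v :: p'] else [::])
    ++ [seq b :: t | t <- insert_in v p']
  else [::].

Definition insertions v p : seq (seq 'I_n) :=
  (if has (G v) p then [:: v :: p] else [::]) ++ insert_in v p.

(** [vs] is to be listed in decreasing order, so that each inserted vertex is the largest so far. *)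
Fixpoint good_seqs x vs : seq (seq 'I_n) :=
  if vs is v :: vs' then flatten [seq insertions v p | p <- good_seqs x vs']
  else [:: [:: x]].

Lemma lower_nbrs_adj v u w : G v u -> G v w -> u < v -> w < v -> u != w -> G u w.
Proof.
have H a b : G v a -> G v b -> a < b -> b < v -> G a b.
  by rewrite ![G v _]Gsym => va vb ab bv; have [] := Gnui ab bv va.
move=> vu vw uv wv; rewrite neq_ltn => /orP[] lt; first exact: H.
by rewrite Gsym; apply: H.
Qed.

Lemma insert_in_ohead v p t : t \in insert_in v p -> ohead t = ohead p.
Proof.
case: p => [|b p] //=; rewrite mem_cat => /orP[|/mapP[t' _ ->] //].
by case: ifP => // _; rewrite inE => /eqP->.
Qed.

Lemma insert_in_perm v p t : t \in insert_in v p -> perm_eq t (v :: p).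
Proof.
elim: p t => [|b p IHp] t //=; rewrite mem_cat => /orP[|/mapP[t' /IHp tp ->]].
  case: ifP => // _; rewrite inE => /eqP->.
  by rewrite (perm_catCA [:: b] [:: v] p).
by rewrite (perm_trans (y := b :: v :: p)) ?perm_cons // (perm_catCA [:: b] [:: v] p).
Qed.

Lemma insertions_perm v p t : t \in insertions v p -> perm_eq t (v :: p).
Proof.
rewrite mem_cat => /orP[|/insert_in_perm //].
by case: ifP => // _; rewrite inE => /eqP->.
Qed.

Lemma insert_in_rem v p t : v \notin p -> t \in insert_in v p -> rem v t = p.
Proof.
elim: p t => [|b p IHp] t //=; rewrite inE negb_or eq_sym => /andP[bv vp].
rewrite mem_cat => /orP[|/mapP[t' /IHp tp ->]].
  by case: ifP => // _; rewrite inE => /eqP-> /=; rewrite (negPf bv) eqxx.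
by rewrite /= (negPf bv) tp.
Qed.

Lemma insertions_rem v p t : v \notin p -> t \in insertions v p -> rem v t = p.
Proof.
move=> vp; rewrite mem_cat => /orP[|/(insert_in_rem vp) //].
by case: ifP => // _; rewrite inE => /eqP-> /=; rewrite eqxx.
Qed.

Lemma insert_in_uniq v p : v \notin p -> uniq (insert_in v p).
Proof.
elim: p => [|b p IHp] //=; rewrite inE negb_or => /andP[bv vp].
rewrite cat_uniq map_inj_uniq; last by move=> ? ? [].
rewrite IHp // andbT.
apply/andP; split; first by case: ifP.
rewrite -all_predC; apply/allP => _ /mapP[t' tp ->] /=; case: ifP => // _.
rewrite mem_seq1; apply/eqP=> -[E]; move: (insert_in_ohead tp); rewrite E /=.
by case: p {IHp tp E} vp => [|c p] //=; rewrite inE negb_or => /andP[/eqP vc _] [].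
Qed.

Lemma insertions_uniq v p : v \notin p -> uniq (insertions v p).
Proof.
move=> vp; rewrite cat_uniq insert_in_uniq // andbT.
apply/andP; split; first by case: ifP.
rewrite -all_predC; apply/allP => t tp /=; case: ifP => // _.
rewrite mem_seq1; apply/eqP=> E; move: (insert_in_ohead tp); rewrite E /=.
by case: p {tp E} vp => [|c p] //=; rewrite inE negb_or => /andP[/eqP vc _] [].
Qed.

Lemma good_nonnil x p : good x p -> p != [::]. Proof. by case: p. Qed.

Lemma good_cons x b p : p != [::] ->
  good x (b :: p) = [&& good x p, b \notin p, has (G b) p & (b < head b p) ==> G b (head b p)].
Proof. by case: p. Qed.

(** Only the steps into and out of [v] are new: the first is an ascent, the second a descent that
    the insertion rule makes an edge. *)
Lemma insertions_good x v p t : v \notin p -> {in p, forall u, u < v} ->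
  good x p -> t \in insertions v p -> good x t.
Proof.
move=> vp ltpv gp; rewrite mem_cat => /orP[].
  case: ifP => // hv; rewrite inE => /eqP->.
  rewrite good_cons ?(good_nonnil gp) // gp vp hv /=.
  case: p gp ltpv {vp hv} => //= c p _ ltpv.
  by rewrite ltnNge ltnW ?ltpv ?mem_head.
elim: p vp ltpv gp t => [|b p IHp] //; rewrite inE negb_or => /andP[bv vp] ltpv gp t.
rewrite /= mem_cat => /orP[|/mapP[t' tp ->]].
  case: ifP => // /andP[vb hv]; rewrite inE => /eqP->.
  have pn : p != [::] by case: p hv {IHp vp ltpv gp}.
  move: gp; rewrite good_cons // => /and4P[gp bp hb _].
  rewrite !good_cons //= gp vp hv inE negb_or eq_sym bv bp [G b v]Gsym vb !andbT /= implybT andbT.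
  case: p pn ltpv {gp IHp vp hv bp hb} => //= c p _ ltpv.
  by rewrite ltnNge ltnW ?ltpv // inE mem_head orbT.
have pn : p != [::] by case: p tp {IHp vp ltpv gp}.
move: gp; rewrite good_cons // => /and4P[gp bp hb hd].
have gt' := IHp vp (fun u up => ltpv u (@mem_behead _ (b :: p) u up)) gp t' tp.
have tperm := perm_mem (insert_in_perm tp).
rewrite good_cons ?(good_nonnil gt') // gt' tperm inE negb_or eq_sym bv bp /=.
have hE : head b t' = head b p.
  by move: (insert_in_ohead tp); case: t' p {IHp gt' tp tperm vp ltpv gp bp hb hd pn} => [|c t'] [|d p] //= [].
rewrite hE hd andbT; apply/hasP.
by case/hasP: hb => u up bu; exists u => //; rewrite tperm inE up orbT.
Qed.

Lemma good_uniq x p : good x p -> uniq p.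
Proof.
elim: p => [|b [|c p] IHp] // /and4P[/IHp up bp _ _].
by rewrite cons_uniq bp up.
Qed.

Lemma good_mem x p : good x p -> x \in p.
Proof.
elim: p => [|b [|c p] IHp] // => [/eqP->|/and4P[/IHp xp _ _ _]]; first exact: mem_head.
by rewrite inE xp orbT.
Qed.

(** The interval condition is used twice. A vertex that loses its only earlier neighbour [v] is
    adjacent to an earlier neighbour of [v], both being smaller neighbours of [v]. And if [v] was
    read between [d] and a smaller [b], the edge from [b] to [v] and [b < d < v] give the edge from
    [b] to [d]. *)
Lemma good_remP x v t : good x t -> v \in t -> v != x ->
  {in t, forall u, u <= v} ->
  [/\ good x (rem v t), has (G v) (rem v t) & t \in insertions v (rem v t)].
Proof.
elim: t => [|b t IHt] // gt vt vx lev.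
have tn : t != [::] by case: t gt vt {IHt lev} => //= /eqP->; rewrite inE (negPf vx).
move: gt; rewrite good_cons // => /and4P[gt bt hb hd].
rewrite /=; have [bv|bv] := eqVneq b v.
  by subst b; rewrite gt hb mem_cat hb mem_head.
have vt' : v \in t by move: vt; rewrite inE eq_sym (negPf bv).
have [gr hv tins] := IHt gt vt' vx (fun u ut => lev u (@mem_behead _ (b :: t) u ut)).
have ltb : b < v by rewrite ltn_neqAle bv lev ?mem_head.
have ut := good_uniq gt.
have ltr u : u \in rem v t -> u < v.
  by rewrite mem_rem_uniq // inE => /andP[uv ut']; rewrite ltn_neqAle uv lev // inE ut' orbT.
have rn := good_nonnil gr.
have hb' : has (G b) (rem v t).
  have /hasP[u ut' bu] := hb.
  have [uv|uv] := eqVneq u v; last first.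
    by apply/hasP; exists u => //; rewrite mem_rem_uniq // inE uv.
  have /hasP[w wr vw] := hv; apply/hasP; exists w => //.
  have wt : w \in t by apply: mem_rem wr.
  apply: (@lower_nbrs_adj v) => //; first by rewrite Gsym -uv.
    exact: ltr.
  by apply: contra bt => /eqP->.
have hasv : has (G v) (b :: rem v t) by rewrite /= hv orbT.
have tin : b :: t \in insertions v (b :: rem v t).
  move: tins; rewrite /insertions !mem_cat hv hasv mem_seq1 => /orP[/eqP tE|tin].
    apply/orP; right; apply/orP; left.
    suff -> : G v b by rewrite /= mem_seq1 {1}tE eqxx.
    by move: hd; rewrite tE /= ltb /= Gsym.
  by rewrite map_f ?orbT.
split=> //; rewrite good_cons // gr hb' mem_rem_uniq // inE negb_and bt orbT /=.
case: t tn gt bt hd rn hv tin ut ltr hb' {IHt lev hb vt vt' gr tins hasv} => // c t _ gt bt /= hd.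
have [cv|cv] := eqVneq c v; last by [].
move: hd; rewrite cv ?eqxx ltb /= => bv' rn hv tin ut ltr hb'.
apply/implyP=> lt; case: t rn {gt bt hv tin ut hb'} ltr lt => // d t _ ltr lt.
have dv : d < v by apply: ltr; rewrite /= ?cv ?eqxx mem_head.
by have [] := Gnui lt dv bv'.
Qed.

Let gt_ord : rel 'I_n := fun a b => b < a.

Lemma mem_good_seqs x vs s : all (fun v => x < v) vs -> pairwise gt_ord vs ->
  (s \in good_seqs x vs) = good x s && perm_eq s (x :: vs).
Proof.
elim: vs s => [|v vs IHvs] s /=.
  rewrite mem_seq1 => _ _; apply/eqP/andP => [->|[_ sx]]; first by rewrite /= eqxx.
  exact/perm_small_eq.
move=> /andP[xv xvs] /andP[/allP vvs pvs].
have ltv u : u \in x :: vs -> u < v by rewrite inE => /predU1P[-> //|/vvs].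
have vn : v \notin x :: vs by apply/negP=> /ltv; rewrite ltnn.
apply/flatten_mapP/andP => [[p]|[gs ps]].
  rewrite IHvs // => /andP[gp pp] sp.
  have vp : v \notin p by rewrite (perm_mem pp).
  split; first by apply: insertions_good sp => // u; rewrite (perm_mem pp) => /ltv.
  apply: perm_trans (insertions_perm sp) _.
  by rewrite perm_sym (perm_catCA [:: x] [:: v] vs) perm_cons perm_sym.
have [||//|gr _ sin] := good_remP gs (v := v).
- by rewrite (perm_mem ps) !inE eqxx orbT.
- by apply: contraTneq xv => ->; rewrite ltnn.
- move=> u; rewrite (perm_mem ps) !inE orbCA => /predU1P[-> //|].
  by rewrite -in_cons => /ltv/ltnW.
exists (rem v s) => //; rewrite IHvs // gr /=.
rewrite -(perm_cons v) -(permPl (perm_to_rem _)) ?(perm_mem ps) ?inE ?eqxx ?orbT //.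
by rewrite (permPl ps) (perm_catCA [:: x] [:: v] vs).
Qed.

Lemma uniq_good_seqs x vs : all (fun v => x < v) vs -> pairwise gt_ord vs ->
  uniq (good_seqs x vs).
Proof.
elim: vs => [|v vs IHvs] //= /andP[xv xvs] /andP[/allP vvs pvs].
have vn : v \notin x :: vs.
  by rewrite inE negb_or neq_ltn xv orbT; apply/negP=> /vvs; rewrite /gt_ord ltnn.
have : {in good_seqs x vs, forall p, v \notin p}.
  by move=> p; rewrite mem_good_seqs // => /andP[_ /perm_mem->].
elim: (good_seqs x vs) (IHvs xvs pvs) => [|p ps IHps] //= /andP[pps ups] vps.
have vp := vps p (mem_head _ _).
have vps' : {in ps, forall p, v \notin p} by move=> p' pp'; rewrite vps // inE pp' orbT.
rewrite cat_uniq insertions_uniq // IHps // andbT -all_predC /=.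
apply/allP=> t /flatten_mapP[p' pp' tp'] /=; apply: contra pps => tp.
by rewrite -(insertions_rem vp tp) (insertions_rem (vps' _ pp') tp').
Qed.

End GoodSequences.

(** * The inversion generating function of good sequences *)

Section GoodSequenceSums.
Local Open Scope ring_scope.
Variables (n : nat) (G : rel 'I_n).
Hypotheses (Gsym : symmetric G) (Girr : irreflexive G)
  (Gnui : natural_unit_interval G).
Variables (A : comNzRingType) (q : A).
Implicit Types (u v w x : 'I_n) (p s t vs : seq 'I_n).

(* Inserting [v] just before its k-th last lower neighbour creates k inversions. *)
Lemma sum_insertions v p : {in p, forall u, (u < v)%N} ->
  \sum_(t <- insertions G v p) q ^+ rinv G t = q ^+ rinv G p * qnum q (count (G v) p).
Proof.
have noinv p' : {in p', forall u, (u < v)%N} ->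
    count (fun a : 'I_n => (v < a)%N && G a v) p' = 0%N.
  move=> lt; apply/eqP; rewrite -leqn0 leqNgt -has_count; apply/hasPn=> u /lt uv.
  by rewrite negb_and -leqNgt ltnW.
have inE' p' : {in p', forall u, (u < v)%N} ->
    (if has (G v) p' then q ^+ rinv G p' else 0) +
    \sum_(t <- insert_in G v p') q ^+ rinv G t = q ^+ rinv G p' * qnum q (count (G v) p').
  elim: p' => [|b p' IHp] lt; first by rewrite /= big_nil addr0 qnum0 mulr0.
  have lt' : {in p', forall u, (u < v)%N} by move=> u up; apply: lt; rewrite inE up orbT.
  have bv : (b < v)%N by apply: lt; rewrite mem_head.
  set c := count (fun a : 'I_n => (b < a)%N && G a b) p'.
  have IH := IHp lt'; rewrite /= big_cat big_map /=.
  have step t : t \in insert_in G v p' ->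
      count (fun a : 'I_n => (b < a)%N && G a b) t = (c + G v b)%N.
    by move=> /insert_in_perm/permP->; rewrite /= bv addnC.
  have rE t : t \in insert_in G v p' ->
      q ^+ rinv G (b :: t) = q ^+ (c + G v b) * q ^+ rinv G t.
    by move=> /step tE; rewrite /= tE addnC exprD.
  rewrite (eq_big_seq _ rE) -big_distrr /= -/c; move: IH; set X := \sum_(t <- _) _.
  case vb: (G v b) => /= IH; last first.
    by rewrite big_nil add0r addn0 add0n exprD mulrAC -IH; case: ifP => _; ring.
  rewrite add1n qnumS; have -> : \sum_(t <- if has (G v) p' then [:: b :: v :: p'] else [::]) q ^+ rinv G t
      = if has (G v) p' then q ^+ rinv G p' * (q ^+ c * q) else 0.
    case: ifP => _; rewrite ?big_nil // big_seq1 /= noinv // addn0 bv vb add1n.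
    by rewrite -exprSr -exprD.
  rewrite exprD addn1 exprSr; set P := q ^+ rinv G p' in IH *; set C := q ^+ c.
  have -> : (if has (G v) p' then P * (C * q) else 0) = (if has (G v) p' then P else 0) * (C * q).
    by case: ifP => _; rewrite ?mul0r.
  rewrite mulrDr mulr1; congr (_ + _); rewrite [C * q * X]mulrC -mulrDl IH; ring.
rewrite big_cat /= => /[dup] lt /inE' <-; congr (_ + _).
by case: ifP => _; rewrite ?big_nil // big_seq1 /= noinv // addn0.
Qed.

(** The factor contributed by inserting [v] is the same for all good sequences on the smaller
    vertices, since the number of neighbours of [v] depends only on the underlying set. *)
Theorem sum_good_seqs x vs : all (fun v => x < v)%N vs ->
  pairwise (fun a b : 'I_n => b < a)%N vs ->
  \sum_(s <- good_seqs G x vs) q ^+ rinv G s = block_weight G q x [set v in vs].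
Proof.
elim: vs => [|v vs IHvs] /=.
  move=> _ _; rewrite big_seq1 /= expr0.
  by rewrite /block_weight big1 // => v; rewrite inE.
move=> /andP[xv xvs] /andP[/allP vvs pvs].
have ltv u : u \in x :: vs -> (u < v)%N by rewrite inE => /predU1P[-> //|/vvs].
rewrite big_flatten big_map /= set_cons block_weight_addmax; first last.
- by move=> u; rewrite inE => /vvs.
- by rewrite inE; apply/negP=> /vvs; rewrite ltnn.
rewrite -IHvs // big_distrr /=; apply: eq_big_seq => s.
rewrite mem_good_seqs // => /andP[gs ps].
rewrite sum_insertions; last by move=> u; rewrite (perm_mem ps) => /ltv.
rewrite mulrC; congr (qnum q _ * _).
have us : uniq s := good_uniq gs.
rewrite -size_filter -(card_uniqP _) ?filter_uniq //; apply: eq_card => u.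
rewrite !inE mem_filter (perm_mem ps) inE andbC; apply: andb_id2l => /ltv-> /=.
by rewrite Gsym.
Qed.
End GoodSequenceSums.

(** * Greedy readings and the recovery of a tree from its reading *)

Section GreedyReading.
Local Open Scope nat_scope.
Variable n : nat.
Implicit Types (a b c m u v w x y z : 'I_n) (p s t : seq 'I_n) (B : {set 'I_n}) (E : rel 'I_n).

(** Reversed, these are the initial segments of the reading that defines [tree_list]. The edge
    relation is kept abstract, because it changes while a tree is built vertex by vertex. *)
Fixpoint greedy B E x p : bool :=
  if p is y :: p' then
    if p' is _ :: _ then
      [&& greedy B E x p', y \in B, y \notin p', has (E y) p' &
          [forall w in B, (w \notin p') && has (E w) p' ==> (y <= w)]]
    else y == x
  else false.

Lemma greedy_cons B E x y p : p != [::] -> greedy B E x (y :: p) =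
  [&& greedy B E x p, y \in B, y \notin p, has (E y) p &
      [forall w in B, (w \notin p) && has (E w) p ==> (y <= w)]].
Proof. by case: p. Qed.

Lemma greedy_nonnil B E x p : greedy B E x p -> p != [::]. Proof. by case: p. Qed.

Lemma greedy_uniq B E x p : greedy B E x p -> uniq p.
Proof.
elim: p => [|y [|c p] IHp] // /and5P[/IHp up _ yp _ _].
by rewrite cons_uniq yp up.
Qed.

Lemma greedy_sub B E x p : x \in B -> greedy B E x p -> {subset p <= B}.
Proof.
move=> xB; elim: p => [|y [|c p] IHp] //.
  by move=> /eqP-> u; rewrite inE => /eqP->.
move=> /and5P[/IHp sp yB _ _ _] u; rewrite inE => /predU1P[-> //|]; exact: sp.
Qed.

Definition top y p : 'I_n :=
  foldr (fun a m : 'I_n => if m < a then a else m) (head y p) p.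

(* The vertex to which [y] gets attached when it is read right after [p]. *)
Definition att y p : 'I_n :=
  if [seq u : 'I_n <- p | y < u] is u :: _ then u else top y p.

(** The edges of a tree recovered from its reading alone: the inverse of the reading map. *)
Fixpoint tedges p : {set {set 'I_n}} :=
  if p is y :: p' then
    if p' is _ :: _ then [set att y p'; y] |: tedges p' else set0
  else set0.

Lemma tedges_cons y p : p != [::] -> tedges (y :: p) = [set att y p; y] |: tedges p.
Proof. by case: p. Qed.

Lemma top_mem y p : p != [::] -> top y p \in p.
Proof.
case: p => // c p _; rewrite /top /=.
have : foldr (fun a m : 'I_n => if m < a then a else m) c p \in c :: p.
  elim: p => [|b p IHp] /=; first by rewrite inE.
  by case: ifP => _; rewrite !inE ?eqxx ?orbT // orbCA -in_cons IHp orbT.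
by case: ifP => // _ _; rewrite mem_head.
Qed.

Lemma top_ge y p u : u \in p -> u <= top y p.
Proof.
rewrite /top; move: (head y p) => c.
elim: p => [|b p IHp] //=; rewrite inE => /predU1P[->|/IHp up].
  by case: ltnP.
by case: ltnP => // /ltnW; apply: leq_trans.
Qed.

Lemma att_mem y p : p != [::] -> att y p \in p.
Proof.
rewrite /att => pn; case E: [seq _ <- p | _] => [|u s]; first exact: top_mem.
have : u \in [seq u : 'I_n <- p | y < u] by rewrite E mem_head.
by rewrite mem_filter => /andP[].
Qed.

Lemma att_cons_lt y c p : y < c -> att y (c :: p) = c.
Proof. by move=> yc; rewrite /att /= yc. Qed.

Lemma att_cons_le y c p u : u \in p -> y < u -> c <= y -> att y (c :: p) = att y p.
Proof.
move=> up yu cy; rewrite /att /= ltnNge cy /=.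
case E: [seq _ <- p | _] => [|//].
by have : u \in [seq u : 'I_n <- p | y < u]; [rewrite mem_filter yu | rewrite E].
Qed.

Lemma att_max y p m : {in p, forall v, v <= y} -> m \in p -> {in p, forall v, v <= m} ->
  att y p = m.
Proof.
move=> lty mp ltm; rewrite /att.
have -> : [seq u : 'I_n <- p | y < u] = [::].
  by apply/eqP; rewrite -[_ == _]negbK -has_filter; apply/hasPn=> v /lty; rewrite -leqNgt.
have pn : p != [::] by case: p mp {lty ltm}.
apply: val_inj; apply: anti_leq; rewrite top_ge // andbT.
by apply: ltm; apply: top_mem.
Qed.

Lemma att_cases y p : p != [::] ->
  {u & {p1 & {p2 | [/\ att y p = u, y < u, p = p1 ++ u :: p2 & {in p1, forall v, v <= y}]}}}
  + {[/\ {in p, forall v, v <= y} & {in p, forall v, v <= att y p}]}.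
Proof.
move=> pn; case: (boolP (has (fun u : 'I_n => y < u) p)) => [hp|/hasPn np].
  left; elim: p {pn} hp => [|c p IHp] //= hp.
  case: (ltnP y c) => yc.
    by exists c, [::], p; rewrite att_cons_lt.
  have hp' : has (fun u : 'I_n => y < u) p by move: hp; rewrite ltnNge yc.
  have [u [p1 [p2 [uE yu pE p1y]]]] := IHp hp'.
  exists u, (c :: p1), p2; rewrite pE; split=> //; last first.
    by move=> v; rewrite inE => /predU1P[-> //|]; exact: p1y.
  by rewrite (@att_cons_le _ _ _ u) // -?pE // pE mem_cat mem_head orbT.
right; have lty : {in p, forall v, v <= y} by move=> v /np; rewrite -leqNgt.
split=> // v vp; have -> : att y p = top y p.
  rewrite /att; have -> // : [seq u : 'I_n <- p | y < u] = [::].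
  by apply/eqP; rewrite -[_ == _]negbK -has_filter; apply/hasPn.
exact: top_ge.
Qed.

End GreedyReading.

(** * [tree_list] as the complete greedy reading *)

Section TreeList.
Local Open Scope nat_scope.
Variables (n : nat).
Implicit Types (a b c m u v w x y z : 'I_n) (p s t : seq 'I_n) (B : {set 'I_n}) (T : pregraph n).

Lemma adj_sym T : symmetric (adj T).
Proof. by move=> u v; rewrite /adj setUC. Qed.

Lemma enum_sorted B : sorted (fun u v : 'I_n => u < v) (enum B).
Proof.
have : sorted (fun u v => u < v) (enum 'I_n).
  have := iota_ltn_sorted 0 n; rewrite -val_enum_ord sorted_map.
  by apply: sub_sorted.
apply: subseq_sorted; first by move=> ? ? ?; apply: ltn_trans.
by rewrite {1}/enum_mem -enumT filter_subseq.
Qed.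

Lemma take1_enum B x : x \in B -> {in B, forall u, x <= u} -> take 1 (enum B) = [:: x].
Proof.
move=> xB xmin; have := enum_sorted B; have : x \in enum B by rewrite mem_enum.
case E: (enum B) => [|y s] //= xs srt; rewrite take0; congr [:: _].
have /xmin xy : y \in B by rewrite -mem_enum E mem_head.
move: xs; rewrite inE => /predU1P[-> //|xs].
have /allP/(_ x xs) : all (fun v : 'I_n => y < v) s.
  by apply: order_path_min srt => ? ? ?; apply: ltn_trans.
by rewrite ltnNge xy.
Qed.

Lemma list_stepP T p y : y \in verts T -> y \notin p -> has (adj T y) p ->
  exists z, list_step T (rev p) = rcons (rev p) z /\
    [/\ z \in verts T, z \notin p, has (adj T z) p &
     [forall w in verts T, (w \notin p) && has (adj T w) p ==> (z <= w)]].
Proof.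
move=> yT yp hy; rewrite /list_step.
have CE w : (w \notin rev p) && has (fun u => adj T u w) (rev p) = (w \notin p) && has (adj T w) p.
  rewrite mem_rev has_rev; congr (_ && _); apply: eq_has => u.
  by rewrite adj_sym.
under eq_filter do rewrite CE.
case E: [seq _ <- _ | _] => [|z s].
  by have : y \in [seq y <- enum (verts T) | (y \notin p) && has (adj T y) p];
    [rewrite mem_filter yp hy mem_enum | rewrite E].
exists z; split=> //.
have : z \in [seq y <- enum (verts T) | (y \notin p) && has (adj T y) p].
  by rewrite E mem_head.
rewrite mem_filter mem_enum => /andP[/andP[zp hz] zT]; split=> //.
apply/forall_inP=> w wT; apply/implyP=> Cw.
have : w \in [seq y <- enum (verts T) | (y \notin p) && has (adj T y) p].
  by rewrite mem_filter Cw mem_enum.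
have : sorted (fun u v : 'I_n => u < v) [seq y <- enum (verts T) | (y \notin p) && has (adj T y) p].
  by apply: sorted_filter (enum_sorted _) => ? ? ?; apply: ltn_trans.
rewrite E /= inE => srt /predU1P[-> //|ws].
have /allP/(_ w ws)/ltnW // : all (fun v : 'I_n => z < v) s.
by apply: order_path_min srt => ? ? ?; apply: ltn_trans.
Qed.

Lemma greedy_iter T x p : x \in verts T -> {in verts T, forall u, x <= u} ->
  greedy (verts T) (adj T) x p ->
  rev (iter (size p).-1 (list_step T) (take 1 (enum (verts T)))) = p.
Proof.
move=> xT xmin; rewrite (take1_enum xT xmin).
elim: p => [|y [|c p] IHp] //; first by move=> /eqP->.
rewrite greedy_cons // => /and5P[/IHp/(canRL revK) IH yT yp hy /forall_inP ymin].
rewrite [size _]/= [_.-1]/= iterS IH.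
have [z [-> [zT zp hz /forall_inP zmin]]] := list_stepP yT yp hy.
rewrite rev_rcons revK; congr (_ :: _); apply: val_inj; apply: anti_leq.
by have /implyP := zmin y yT; have /implyP := ymin z zT; rewrite yp hy zp hz => -> // ->.
Qed.

Lemma greedy_tree_list T x p : x \in verts T -> {in verts T, forall u, x <= u} ->
  greedy (verts T) (adj T) x p -> size p = #|verts T| -> tree_list T = rev p.
Proof.
by move=> xT xmin gp sp; rewrite /tree_list -sp -{2}(greedy_iter xT xmin gp) revK.
Qed.

Lemma exists_greedy T x : x \in verts T ->
  {in verts T &, forall u v, connect (adj T) u v} ->
  (forall u v, adj T u v -> v \in verts T) ->
  exists2 p, greedy (verts T) (adj T) x p & size p = #|verts T|.
Proof.
move=> xT conn sub.
suff: forall k, 0 < k <= #|verts T| -> exists2 p, greedy (verts T) (adj T) x p & size p = k.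
  by apply; rewrite leqnn andbT; apply/card_gt0P; exists x.
elim=> [|[|k] IHk] // /andP[_ kT].
  by exists [:: x] => //=.
have [p gp sp] := IHk (ltnW kT).
have xp : x \in p.
  elim: p gp {sp} => [|y [|c p] IHp] //; first by rewrite inE eq_sym.
  by rewrite greedy_cons // => /and5P[/IHp xp _ _ _ _]; rewrite in_cons xp orbT.
have [w wT wp] : exists2 w, w \in verts T & w \notin p.
  apply/exists_inP; rewrite -[[exists _ in _, _]]negbK negb_exists_in.
  apply/negP=> /forall_inP H; move: kT; rewrite -sp ltnNge => /negP; apply.
  have up := greedy_uniq gp; rewrite -(card_uniqP up).
  by apply/subset_leq_card/subsetP=> w /H; rewrite negbK.
(* On a path from [x] to the unread vertex [w], the first vertex outside [p] has its predecessor in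
   [p]. *)
have [y [yT yp hy]] : exists y, [/\ y \in verts T, y \notin p & has (adj T y) p].
  have /connectP[s] := conn x w xT wT.
  move: {conn IHk gp xT}x xp => x'; elim: s x' => [|z s IHs] u up /=; first by move=> _ wu; rewrite wu up in wp.
  move=> /andP[uz pz] wl; have [zp|zp] := boolP (z \in p); first exact: IHs pz wl.
  by exists z; split; [exact: sub uz | | apply/hasP; exists u; rewrite // adj_sym].
have [z [_ [zT zp hz zmin]]] := list_stepP yT yp hy.
exists (z :: p); last by rewrite /= sp.
by rewrite greedy_cons ?(greedy_nonnil gp) // gp zT zp hz.
Qed.

End TreeList.

(** * From decreasing subtrees to good sequences *)

Section DecreasingTrees.
Local Open Scope nat_scope.
Variables (n : nat) (G : rel 'I_n).
Hypotheses (Gsym : symmetric G) (Girr : irreflexive G)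
  (Gnui : natural_unit_interval G).
Implicit Types (a b c m u v w x y z : 'I_n) (p s t : seq 'I_n).
Implicit Types (B : {set 'I_n}) (T : pregraph n).

Lemma set2_inj (I : finType) (a b u v : I) : [set u; v] = [set a; b] ->
  (u = a /\ v = b) \/ (u = b /\ v = a).
Proof.
move=> E.
have: u \in [set a; b] by rewrite -E set21.
have: v \in [set a; b] by rewrite -E set22.
have: a \in [set u; v] by rewrite E set21.
have: b \in [set u; v] by rewrite E set22.
rewrite !inE => /orP[]/eqP-> /orP[]/eqP-> /orP[]/eqP H1 /orP[]/eqP H2; subst; by [left | right].
Qed.

Section Greedy.
Variables (B : {set 'I_n}) (E : rel 'I_n) (x : 'I_n).
Hypotheses (Esym : symmetric E) (EG : subrel E G).
Hypothesis Euniq : forall u v w, E u v -> E u w -> u < v -> u < w -> v = w.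

(* A read set is connected, so only its largest vertex has an unread parent. *)
Lemma greedy_parent p u : greedy B E x p -> u \in p -> ~~ all (fun v => v <= u) p ->
  exists w, [/\ w \in p, u < w & E u w].
Proof.
elim: p u => [|y p IHp] // u.
case: (eqVneq p [::]) => [-> _|pn].
  by rewrite inE => /eqP->; rewrite /= leqnn.
rewrite greedy_cons // => /and5P[/IHp {}IHp yB yp /hasP[v vp yv] ymin].
have vy : v != y by apply: contraNneq yp => <-.
have vmax : v < y -> {in p, forall w, w <= v}.
  move=> lt; apply/allP; rewrite -[all _ _]negbK; apply/negP=> /(IHp v vp)[w [wp vw Evw]].
  have := Euniq Evw _ vw lt; rewrite Esym => /(_ yv) wy.
  by rewrite wy (negPf yp) in wp.
rewrite inE => /predU1P[->|up] /= nmax; last first.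
  have [allu|/(IHp u up)[w [wp uw Euw]]] := boolP (all (fun v => v <= u) p); last first.
    by exists w; rewrite inE wp orbT.
  move: nmax; rewrite allu andbT -ltnNge => uy.
  have vu := allP allu v vp.
  have uv := vmax (leq_ltn_trans vu uy) u up.
  have uE : u = v by apply: val_inj; apply: anti_leq; rewrite uv.
  by exists y; rewrite mem_head uy uE Esym.
move: nmax; rewrite leqnn /= => nmax.
exists v; rewrite inE vp orbT; split=> //.
rewrite ltn_neqAle eq_sym vy leqNgt; apply: contra nmax => lt.
by apply/allP=> w /(vmax lt) wv; apply: leq_trans wv (ltnW lt).
Qed.

(** From the moment [u] is read, [y] is a candidate; whatever is read while [y] has to wait is at
    most [y]. So [u] is the last vertex read that exceeds [y]. *)
Lemma greedy_att_gt p y u : greedy B E x p -> y \in B -> y \notin p -> u \in p ->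
  E y u -> y < u -> att y p = u.
Proof.
move=> + yB; elim: p => [|c p IHp] //.
case: (eqVneq p [::]) => [-> _ _|pn].
  by rewrite inE => /eqP-> _ yc; rewrite att_cons_lt.
rewrite greedy_cons // => /and5P[gp cB cp hc /forall_inP cmin].
rewrite inE negb_or => /andP[yc yp]; rewrite inE => /predU1P[-> _ yu|up Eyu yu].
  exact: att_cons_lt.
rewrite (att_cons_le up) ?IHp //.
have /implyP := cmin y yB; rewrite yp /=; apply.
by apply/hasP; exists u.
Qed.

(** If the neighbour [u] is smaller than [y], then [y] is its only larger neighbour. As [y] was
    unread, [greedy_parent] makes [u] the maximum of [p], which is the fallback value of [att]. *)
Lemma greedy_att p y u : p != [::] -> greedy B E x (y :: p) -> u \in p -> E y u -> att y p = u.
Proof.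
move=> pn; rewrite greedy_cons // => /and5P[gp yB yp hy ymin] up Eyu.
have yu : y != u by apply: contraNneq yp => ->.
case: (ltngtP y u) => [lt|lt|/val_inj eq]; last by rewrite eq eqxx in yu.
  exact: greedy_att_gt gp yB yp up Eyu lt.
have maxu : {in p, forall v, v <= u}.
  apply/allP; rewrite -[all _ _]negbK; apply/negP=> /(greedy_parent gp up)[w [wp uw Euw]].
  have := Euniq Euw _ uw lt; rewrite Esym => /(_ Eyu) wy.
  by rewrite wy (negPf yp) in wp.
by apply: att_max => // v /maxu vu; apply: leq_trans vu (ltnW lt).
Qed.

(** Suppose [y] is read right after a larger [c]. A neighbour of [y] read before [c] would have made
    [y] a candidate when [c] was chosen, against minimality. So [c] itself is the neighbour, and the
    descent is an edge. *)
Lemma greedy_good p : greedy B E x p -> good G x p.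
Proof.
elim: p => [|y p IHp] //; case: (eqVneq p [::]) => [-> //|pn] gyp.
move: (gyp); rewrite greedy_cons // => /and5P[gp yB yp /hasP[v vp Eyv] ymin].
rewrite good_cons // IHp // yp /=; apply/andP; split.
  by apply/hasP; exists v => //; apply: EG.
case: p pn gp vp yp {gyp ymin IHp} => // c p _ gp vp yp /=; apply/implyP=> yc.
move: vp; rewrite inE => /predU1P[<-|vp]; first exact: EG.
have pn : p != [::] by case: p vp {gp yp}.
move: gp; rewrite greedy_cons // => /and5P[_ _ _ _ /forall_inP cmin].
move: yp; rewrite inE negb_or => /andP[_ yp].
have /implyP := cmin y yB; rewrite yp /= leqNgt yc; case/(_ _)/negP => //.
by apply/hasP; exists v.
Qed.

Lemma greedy_edges_sub p a b : greedy B E x p -> a \in p -> b \in p -> E a b ->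
  [set a; b] \in tedges p.
Proof.
elim: p => [|y p IHp] //; case: (eqVneq p [::]) => [->|pn] gyp.
  by move=> /[!inE] /eqP-> /eqP-> Eyy; have := EG Eyy; rewrite Girr.
move: (gyp); rewrite greedy_cons // => /and5P[gp _ _ _ _].
rewrite tedges_cons // !inE => /predU1P[->|ap] /predU1P[->|bp] Eab.
- by have := EG Eab; rewrite Girr.
- by rewrite (greedy_att pn gyp bp Eab) setUC eqxx.
- by rewrite Esym in Eab; rewrite (greedy_att pn gyp ap Eab) eqxx.
- by rewrite IHp // orbT.
Qed.

Lemma greedy_edges_sup p e : greedy B E x p -> e \in tedges p ->
  exists a b, E a b /\ e = [set a; b].
Proof.
elim: p => [|y p IHp] //.
case: (eqVneq p [::]) => [->|pn] gyp; first by rewrite in_set0.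
move: (gyp); rewrite greedy_cons // => /and5P[gp _ _ /hasP[v vp Eyv] _].
rewrite tedges_cons // inE => /orP[|/IHp]; last by apply.
rewrite inE => /eqP->; exists v, y; split; first by rewrite Esym.
by rewrite (greedy_att pn gyp vp Eyv).
Qed.

End Greedy.

(** The smallest vertex of a cycle would have two distinct larger neighbours. *)
Lemma acyclic_of_parent (E : rel 'I_n) (C : seq 'I_n) : symmetric E ->
  (forall u v w, E u v -> E u w -> u < v -> u < w -> v = w) ->
  2 < size C -> ~~ ucycleb E C.
Proof.
move=> Esym Euniq szC; apply/negP=> /andP[cyC uC].
have [m0 m0C] : exists m, m \in C by case: C szC {cyC uC} => // m C _; exists m; rewrite mem_head.
have [m mC mmin] := arg_minnP (fun u : 'I_n => u : nat) m0C.
have [i s rE] := rot_to mC.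
have cyR : cycle E (m :: s) by rewrite -rE rot_cycle.
have uR : uniq (m :: s) by rewrite -rE rot_uniq.
have szR : 2 < size (m :: s) by rewrite -rE size_rot.
have minR u : u \in s -> m < u.
  move=> us; rewrite ltn_neqAle; apply/andP; split.
    by apply: contraTneq us => /val_inj <-; case/andP: uR.
  have uinC : u \in C by rewrite -(mem_rot i) rE inE us orbT.
  exact: mmin.
case: s cyR uR szR minR {rE} => [|a s] //= /andP[ma]; rewrite rcons_path => /andP[_ lm].
case: s lm => [|b s] //= lm /and3P[_ /negP as_ _] _ minR; apply: as_.
rewrite (@Euniq m a (last b s)) ?mem_last ?minR ?mem_head //; first by rewrite Esym.
by rewrite inE mem_last orbT.
Qed.

Lemma decreasing_parent T u v w : is_decreasing T -> is_subgraph G T ->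
  adj T u v -> adj T u w -> u < v -> u < w -> v = w.
Proof.
move=> dT sT uv uw ltv ltw.
have memT a b : adj T a b -> a \in verts T /\ b \in verts T.
  move=> ab; have /exists_inP[c cT /exists_inP[d dT' /andP[_ /eqP/set2_inj]]] := forall_inP sT _ ab.
  by case=> -[-> ->].
have [uT vT] := memT _ _ uv; have [_ wT] := memT _ _ uw.
have /implyP := forall_inP dT u uT.
have -> : [exists y in verts T, u < y] by apply/exists_inP; exists v.
move=> /(_ isT)/cards1P[z zE].
have: v \in [set y in verts T | (u < y) && adj T u y] by rewrite inE vT ltv.
have: w \in [set y in verts T | (u < y) && adj T u y] by rewrite inE wT ltw.
by rewrite zE !inE => /eqP-> /eqP->.
Qed.

(** The equation for the edges says that the list determines the tree, which makes the reading
    injective. *)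
Theorem decreasing_subtree_good T x : decreasing_subtree G T ->
  x \in verts T -> {in verts T, forall u, x <= u} ->
  let p := rev (tree_list T) in
  [/\ good G x p, p =i verts T, uniq p & edges T = tedges p].
Proof.
move=> /and3P[sT /and3P[_ cT _] dT] xT xmin.
have adjP a b : adj T a b -> [/\ a \in verts T, b \in verts T & G a b].
  move=> ab; have /exists_inP[c cT' /exists_inP[d dT' /andP[Gcd /eqP/set2_inj]]] := forall_inP sT _ ab.
  by case=> -[-> ->]; rewrite // Gsym.
have par := fun u v w => @decreasing_parent T u v w dT sT.
have conn : {in verts T &, forall u v, connect (adj T) u v}.
  by move=> u v uT vT; have /forall_inP := forall_inP cT u uT; apply.
have [|p gp sp] := exists_greedy xT conn; first by move=> u v /adjP[].
have EG : subrel (adj T) G by move=> u v /adjP[].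
have pT : p =i verts T.
  apply/subset_cardP; first by rewrite (card_uniqP (greedy_uniq gp)).
  by apply/subsetP; apply: greedy_sub xT gp.
rewrite /= (greedy_tree_list xT xmin gp sp) revK; split=> //.
- by apply: greedy_good gp.
- exact: greedy_uniq gp.
apply/setP=> e; apply/idP/idP => [eT|/(greedy_edges_sup (adj_sym T) par gp)[a [b [ab ->]]] //].
have /exists_inP[c cT' /exists_inP[d dT' /andP[Gcd /eqP eE]]] := forall_inP sT _ eT.
by rewrite eE; apply: (greedy_edges_sub (adj_sym T) EG par gp); rewrite ?pT // /adj -eE.
Qed.

End DecreasingTrees.

(** * From good sequences to decreasing subtrees *)

Section GoodTrees.
Local Open Scope nat_scope.
Variables (n : nat) (G : rel 'I_n).
Hypotheses (Gsym : symmetric G) (Girr : irreflexive G)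
  (Gnui : natural_unit_interval G).
Implicit Types (a b c m u v w x y z : 'I_n) (p s t : seq 'I_n).
Implicit Types (B : {set 'I_n}) (T : pregraph n).

Lemma good_catr x s p : p != [::] -> good G x (s ++ p) -> good G x p.
Proof.
move=> pn; elim: s => [|b s IHs] //=; rewrite -/(good G x (b :: (s ++ p))).
by rewrite good_cons => [/and4P[/IHs]|] //; case: s {IHs} => //=; case: p pn.
Qed.

(** Let [u] be the last vertex read that exceeds [y]. Either [y] follows it directly, by a descent,
    or some [d < y] does; then the descent from [u] to [d] is an edge that spans [y]. If no vertex
    of [p] exceeds [y], then an edge from an earlier neighbour [w] to [y] spans the maximum of [p],
    unless [w] is that maximum. *)
Lemma good_att_adj x y p : p != [::] -> good G x (y :: p) -> G y (att y p).
Proof.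
move=> pn gyp; move: (gyp); rewrite good_cons // => /and4P[gp yp /hasP[w wp yw] hd].
case: (att_cases y pn) => [[u [p1 [p2 [-> yu pE p1y]]]]|[lty ltm]].
  move: pE; case: (lastP p1) p1y => [|p1' d] p1y pE.
    by move: hd; rewrite pE /= yu.
  have dy : d < y.
    rewrite ltn_neqAle p1y ?mem_rcons ?mem_head // andbT.
    by apply: contraNneq yp => /val_inj <-; rewrite pE mem_cat mem_rcons mem_head.
  have : good G x (d :: u :: p2).
    by apply: (@good_catr x p1') => //; rewrite -cat_rcons -pE.
  move=> /and4P[_ _ _]; rewrite (ltn_trans dy yu) /= => du.
  by have [] := Gnui dy yu du.
have wm : w <= att y p := ltm w wp.
have my : att y p < y.
  rewrite ltn_neqAle lty ?att_mem // andbT.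
  by apply: contraNneq yp => /val_inj <-; apply: att_mem.
have [<-//|wn] := eqVneq w (att y p).
have lt : w < att y p by rewrite ltn_neqAle wn.
by rewrite Gsym; have [] := Gnui lt my; rewrite // Gsym.
Qed.

Lemma uniq_cat_mem (I : eqType) (s1 s2 t1 t2 : seq I) (u y : I) :
  uniq (s1 ++ u :: s2) -> s1 ++ u :: s2 = t1 ++ y :: t2 -> u \in t2 -> y \in s1.
Proof.
elim: s1 t1 => [|b s1 IHs] [|c t1] //=.
- by move=> /andP[us _] [<- <-] ut; rewrite ut in us.
- move=> /andP[us _] [_ E] ut; case/negP: us; by rewrite E mem_cat inE ut !orbT.
- by move=> _ [-> _] _; rewrite mem_head.
by move=> /andP[_ us] [_ E] ut; rewrite inE (IHs t1) ?orbT.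
Qed.

Definition etree p : rel 'I_n := fun u v => [set u; v] \in tedges p.

Lemma etree_sym p : symmetric (etree p).
Proof. by move=> u v; rewrite /etree setUC. Qed.

Lemma etree_cons y p u v : p != [::] ->
  etree (y :: p) u v = ([set u; v] == [set att y p; y]) || etree p u v.
Proof. by move=> pn; rewrite /etree tedges_cons // !inE. Qed.

Lemma etree1 c u v : etree [:: c] u v = false.
Proof. by rewrite /etree in_set0. Qed.

Lemma etree_adj x p u v : good G x p -> etree p u v -> [/\ u \in p, v \in p & G u v].
Proof.
elim: p => [|y p IHp] //; have [->|pn] := eqVneq p [::]; first by rewrite etree1.
move=> /[dup] gyp; rewrite good_cons // => /and4P[gp yp _ _].
have gatt := good_att_adj pn gyp; have mp := att_mem y pn.
rewrite etree_cons // => /orP[/eqP/set2_inj[[-> ->]|[-> ->]]|/(IHp gp)[up vp Guv]].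
- by rewrite !inE eqxx mp orbT Gsym.
- by rewrite !inE eqxx mp orbT.
- by rewrite !inE up vp !orbT.
Qed.

Lemma etree_connect x p u : good G x p -> u \in p -> connect (etree p) u x.
Proof.
elim: p u => [|y p IHp] // u; have [->|pn] := eqVneq p [::].
  by move=> /eqP->; rewrite inE => /eqP->.
rewrite good_cons // => /and4P[gp yp _ _].
have sub v w : connect (etree p) v w -> connect (etree (y :: p)) v w.
  by apply: connect_sub => a b ab; apply: connect1; rewrite etree_cons // ab orbT.
rewrite inE => /predU1P[->|/(IHp u gp)/sub //].
apply: connect_trans (sub _ _ (IHp _ gp (att_mem y pn))).
by apply: connect1; rewrite etree_cons // setUC eqxx.
Qed.

(** A new vertex is either attached to a larger one, which becomes its parent, or is a new maximum
    attached to the old maximum and becomes the parent of the latter. No other vertex gains a larger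
    neighbour. *)
Lemma etree_parent x p u : good G x p -> u \in p -> ~~ all (fun v => v <= u) p ->
  exists w, forall v, (u < v) && etree p u v = (v == w).
Proof.
elim: p u => [|y p IHp] // u; have [-> _|pn] := eqVneq p [::].
  by rewrite inE => /eqP->; rewrite /= leqnn.
rewrite good_cons // => /and4P[gp yp _ _].
have Ep := etree_adj gp; have ap := att_mem y pn.
rewrite inE => /predU1P[->|up] /= nmax.
  case: (att_cases y pn) => [[a [p1 [p2 [aE ya _ _]]]]|[lty _]]; last first.
    by case/negP: nmax; rewrite leqnn; apply/allP.
  exists a => v; rewrite etree_cons // aE.
  have -> : etree p y v = false by apply: contraNF yp => /Ep[].
  rewrite orbF; apply/andP/eqP => [[yv /eqP/set2_inj[[_ vy]|[_ ->]]] //|->].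
    by rewrite vy ltnn in yv.
  by rewrite ya setUC.
have uy : u != y by apply: contraNneq yp => <-.
have edge v : ([set u; v] == [set att y p; y]) = (u == att y p) && (v == y).
  apply/eqP/andP => [/set2_inj[[-> ->]|[E _]] //|[/eqP-> /eqP->] //].
  by rewrite E eqxx in uy.
have [allu|nall] := boolP (all (fun v => v <= u) p).
  have lt : u < y by move: nmax; rewrite allu andbT -ltnNge.
  exists y => v; rewrite etree_cons // edge.
  have -> : att y p = u.
    apply: att_max => // [w wp|]; last exact/allP.
    exact: leq_trans (allP allu w wp) (ltnW lt).
  rewrite eqxx; apply/andP/eqP => [[uv /orP[/eqP //|/Ep[_ vp _]]]|->].
    by move: (allP allu v vp); rewrite leqNgt uv.
  by rewrite eqxx lt.
have [w wE] := IHp u gp up nall; exists w => v; rewrite etree_cons // edge.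
have [ua|_] := eqVneq u (att y p); last exact: wE.
case: (att_cases y pn) => [[a [p1 [p2 [aE ya _ _]]]]|[_ ltm]]; last first.
  by case/negP: nall; apply/allP=> b; rewrite ua; apply: ltm.
have [vy|_] := eqVneq v y; last exact: wE.
rewrite -wE vy; have -> : (u < y) = false by rewrite ua aE ltnNge ltnW.
by [].
Qed.

(* A vertex read later only competes with those read before its attachment. *)
Lemma greedy_extend B (E E' : rel 'I_n) x z a p : greedy B E x p -> z \notin p ->
  (forall u v, v != z -> u != z -> E' u v = E u v) ->
  (forall u, E' z u -> u = a) ->
  (forall r y p', p = r ++ y :: p' -> a \in p' -> y <= z) ->
  greedy (z |: B) E' x p.
Proof.
move=> + + EE' Ez; elim: p => [|y p IHp] //; have [-> //|pn] := eqVneq p [::].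
rewrite !greedy_cons // inE negb_or => /and5P[gp yB yp /hasP[v vp Eyv] /forall_inP ymin].
move=> /andP[zy zp] late; apply/and5P; split=> //.
- by apply: IHp => // r y' p' pE; apply: (late (y :: r)); rewrite pE.
- by rewrite inE yB orbT.
- have vz : v != z by apply: contraNneq zp => <-.
  by apply/hasP; exists v; rewrite // EE' // eq_sym.
apply/forall_inP=> w wB; apply/implyP=> /andP[wp /hasP[u up Ewu]].
have [wz|wz] := eqVneq w z.
  by rewrite wz in Ewu *; apply: (late [::] y p) => //; rewrite -(Ez u Ewu).
case/setU1P: wB => [wz'|wB]; first by rewrite wz' eqxx in wz.
have /implyP := ymin w wB; apply; rewrite wp; apply/hasP; exists u => //.
by rewrite -EE' //; apply: contraNneq zp => <-.
Qed.

Lemma good_greedy x p : good G x p -> greedy [set v in p] (etree p) x p.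
Proof.
elim: p => [|z p IHp] //; have [-> //|pn] := eqVneq p [::].
move=> /[dup] gzp; rewrite good_cons // => /and4P[gp zp _ _].
have Ep := etree_adj gp; have ap := att_mem z pn.
rewrite greedy_cons // set_cons; apply/and5P; split=> //.
- apply: (@greedy_extend _ (etree p) _ _ _ (att z p)) => //; first exact: IHp.
  + move=> u v vz uz; rewrite etree_cons //.
    have /negPf-> // : [set u; v] != [set att z p; z].
    by apply/eqP=> /set2_inj[[_ /eqP]|[/eqP]]; rewrite ?(negPf vz) ?(negPf uz).
  + move=> u; rewrite etree_cons // => /orP[/eqP/set2_inj[[E]|[_ ->]] //|/Ep[E]].
      by rewrite E ap in zp.
    by rewrite E in zp.
  (* Vertices read after [att z p] are at most [z], either because they lie in [p1] or because all
     of [p] does not exceed [z]. So the new candidate [z] never displaces an earlier choice. *)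
  move=> r y p' pE; case: (att_cases z pn) => [[u [p1 [p2 [-> zu pE' p1z]]]]|[lt _]]; last first.
    by move=> _; apply: lt; rewrite pE mem_cat mem_head orbT.
  move=> up'; apply: p1z; have up := good_uniq gp.
  move: up; rewrite {1}pE' => up.
  exact: uniq_cat_mem up (etrans (esym pE') pE) up'.
- by rewrite !inE eqxx.
- by apply/hasP; exists (att z p); rewrite // etree_cons // setUC eqxx.
apply/forall_inP=> w; rewrite !inE => /predU1P[->|wp]; first by rewrite leqnn implybT.
by rewrite wp.
Qed.

(** Surjectivity of the reading onto good sequences. Acyclicity needs no separate induction: it
    follows from the decreasing condition. *)
Theorem good_decreasing_subtree x p : good G x p -> {in p, forall u, x <= u} ->
  let T : pregraph n := ([set v in p], tedges p) in
  decreasing_subtree G T /\ tree_list T = rev p.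
Proof.
move=> gp xmin; set T : pregraph n := (_, _); have Ep := etree_adj gp.
have xT : x \in verts T by rewrite inE; apply: good_mem gp.
have up := good_uniq gp.
split; last first.
  apply: (greedy_tree_list xT); first by move=> u; rewrite inE; apply: xmin.
    exact: good_greedy.
  by rewrite -(card_uniqP up); apply: eq_card => v; rewrite inE.
have sT : is_subgraph G T.
  apply/forall_inP=> e; rewrite /edges /= => eT.
  have [a [b eE]] : exists a b, e = [set a; b].
    elim: p eT {gp xmin T Ep xT up} => [|y [|c p] IHp]; rewrite ?in_set0 //.
    by rewrite tedges_cons // inE => /orP[|//]; rewrite inE => /eqP->; exists (att y (c :: p)), y.
  have [ap bp Gab] : [/\ a \in p, b \in p & G a b] by apply: Ep; rewrite /etree -eE.
  apply/exists_inP; exists a; first by rewrite inE.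
  apply/exists_inP; exists b; first by rewrite inE.
  by rewrite Gab eE eqxx.
have dT : is_decreasing T.
  apply/forall_inP=> u; rewrite inE => up'; apply/implyP=> /exists_inP[v].
  rewrite inE => vp uv.
  have [|w wE] := etree_parent gp up'.
    by apply/allPn; exists v; rewrite // -ltnNge.
  apply/cards1P; exists w; apply/setP=> y; rewrite !inE -wE.
  by apply/andP/idP => [[]//|/[dup] H /andP[_ /Ep[]]].
apply/and3P; split=> //; apply/and3P; split=> //.
- by apply/set0Pn; exists x.
- apply/forall_inP=> u; rewrite inE => up'; apply/forall_inP=> v; rewrite inE => vp.
  apply: connect_trans (etree_connect gp up') _.
  by rewrite (sym_connect_sym (etree_sym p)) (etree_connect gp).
apply/forallP=> C; apply/implyP=> szC; apply: (acyclic_of_parent (adj_sym T)) szC.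
by move=> u v w; apply: decreasing_parent dT sT.
Qed.

End GoodTrees.

(** * Inversions of lists and the sum over decreasing subtrees with given vertices *)

Section SubtreeSums.
Local Open Scope nat_scope.
Variables (n : nat) (G : rel 'I_n).
Hypotheses (Gsym : symmetric G) (Girr : irreflexive G)
  (Gnui : natural_unit_interval G).
Implicit Types (a b u v w x y z : 'I_n) (p s t : seq 'I_n).
Implicit Types (B : {set 'I_n}) (T : pregraph n).

Fixpoint ninv s : nat :=
  if s is a :: s' then count (fun b => (b < a) && G b a) s' + ninv s' else 0.

Lemma inv_ninv s : Defs.inv G s = ninv s.
Proof.
pose f s := \sum_(i < size s) \sum_(j < size s)
  [&& i < j, tnth (in_tuple s) j < tnth (in_tuple s) i &
      G (tnth (in_tuple s) j) (tnth (in_tuple s) i)] : nat.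
have -> : Defs.inv G s = f s.
  rewrite /Defs.inv /f -sum1_card pair_big /= big_mkcond /=.
  by apply: eq_bigr => -[i j] _; rewrite inE /=; case: ifP.
elim: s => [|a s IHs]; first by rewrite /f big_ord0.
rewrite /f big_ord_recl big_ord_recl /= add0n; congr (_ + _).
  rewrite (eq_bigr (fun j : 'I_(size s) => ((tnth (in_tuple s) j < a) && G (tnth (in_tuple s) j) a) : nat)); last first.
    by move=> j _; rewrite /= !(tnth_nth a).
  rewrite -[in RHS](in_tupleE s) -[in RHS](map_tnth_enum (in_tuple s)) count_map.
  rewrite -sum1_count big_enum_cond /= [RHS]big_mkcond /=.
  by apply: eq_bigr => j _; case: ifP.
rewrite -IHs /f; apply: eq_bigr => i _; rewrite big_ord_recl /= add0n.
by apply: eq_bigr => j _; rewrite !(tnth_nth a) /= /bump /= !add1n.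
Qed.

Lemma ninv_cat s t : ninv (s ++ t) =
  ninv s + ninv t + \sum_(a <- s) count (fun b => (b < a) && G b a) t.
Proof.
elim: s => [|a s IHs] /=; first by rewrite big_nil addn0.
rewrite big_cons IHs count_cat; lia.
Qed.

Lemma ninv_rev p : ninv (rev p) = rinv G p.
Proof.
elim: p => [|b p IHp] //; rewrite [RHS]/= rev_cons -cats1 ninv_cat IHp /= !addn0; congr (_ + _).
rewrite -sum1_count [RHS]big_mkcond /= (perm_big p) ?perm_rev //.
by apply: eq_bigr => a _; rewrite addn0 Gsym; case: ifP.
Qed.

Variables (A : comNzRingType) (q : A).
Local Open Scope ring_scope.

Theorem sum_decreasing_subtrees B x : x \in B -> {in B, forall u, (x <= u)%N} ->
  \sum_(T : pregraph n | decreasing_subtree G T && (verts T == B))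
     q ^+ Defs.inv G (tree_list T) = block_weight G q x (B :\ x).
Proof.
move=> xB xmin; pose vs := rev (enum (B :\ x)).
have vsE : [set v in vs] = B :\ x by apply/setP=> v; rewrite inE mem_rev mem_enum.
have xvs : all (fun v : 'I_n => x < v)%N vs.
  apply/allP=> v; rewrite mem_rev mem_enum => /setD1P[vx vB].
  by rewrite ltn_neqAle eq_sym vx xmin.
have pvs : pairwise (fun a b : 'I_n => b < a)%N vs.
  rewrite -sorted_pairwise; last by move=> a b c /= ba ac; apply: ltn_trans ac ba.
  by rewrite rev_sorted; apply: enum_sorted.
have xvsB : x :: vs =i B.
  by move=> v; rewrite inE mem_rev mem_enum !inE; case: eqP => [->|].
have uxvs : uniq (x :: vs).
  by rewrite /= mem_rev mem_enum !inE eqxx rev_uniq enum_uniq.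
rewrite -vsE -(sum_good_seqs Gsym Gnui q xvs pvs).
pose trees := [seq T <- index_enum (pregraph n) | decreasing_subtree G T && (verts T == B)].
have treesP T : T \in trees -> [/\ decreasing_subtree G T, verts T = B,
    x \in verts T & {in verts T, forall u, (x <= u)%N}].
  by rewrite mem_filter => /andP[/andP[dT /eqP TB] _]; rewrite TB.
have rE T : rinv G (rev (tree_list T)) = Defs.inv G (tree_list T).
  by rewrite -ninv_rev revK inv_ninv.
transitivity (\sum_(s <- [seq rev (tree_list T) | T <- trees]) q ^+ rinv G s).
  rewrite big_map big_filter /=; apply: eq_bigr => T _.
  by rewrite rE.
apply: perm_big; apply: uniq_perm.
- rewrite map_inj_in_uniq ?filter_uniq ?index_enum_uniq //.
  move=> T1 T2 /treesP[d1 B1 x1 m1] /treesP[d2 B2 x2 m2] E.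
  have [_ _ _ e1] := decreasing_subtree_good Gsym Girr d1 x1 m1.
  have [_ _ _ e2] := decreasing_subtree_good Gsym Girr d2 x2 m2.
  case: T1 T2 {d1 d2 x1 x2 m1 m2} B1 B2 E e1 e2 => V1 E1 [V2 E2] /= -> -> E e1 e2.
  by congr pair; rewrite -[E1]/(edges (V1, E1)) e1 E -e2.
- exact: uniq_good_seqs.
move=> s; rewrite mem_good_seqs //; apply/mapP/andP.
  move=> [T /treesP[dT TB xT mT] ->].
  have [gT memT uT _] := decreasing_subtree_good Gsym Girr dT xT mT.
  split=> //; apply: uniq_perm => // v.
  by rewrite xvsB memT TB.
move=> [gs ps].
have sB : s =i B by move=> v; rewrite (perm_mem ps) xvsB.
have [|dT tl] := good_decreasing_subtree Gsym Gnui gs.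
  by move=> u; rewrite sB; apply: xmin.
exists ([set v in s], tedges s); last by rewrite tl revK.
rewrite mem_filter dT mem_index_enum andbT /=; apply/eqP/setP=> v.
by rewrite inE sB.
Qed.

End SubtreeSums.

(** * Forest triples on a set of vertices and their recursion *)

Section ForestSums.
Local Open Scope nat_scope.
Variables (n : nat) (G : rel 'I_n).
Hypotheses (Gsym : symmetric G) (Girr : irreflexive G)
  (Gnui : natural_unit_interval G).
Implicit Types (a b u v w x y z : 'I_n) (s : seq 'I_n).
Implicit Types (B W M R : {set 'I_n}) (T : pregraph n).
Implicit Types (t : pretriple n) (F : seq (pretriple n)).

(** The analogue of [forest_triple] for the vertices [W] that remain once the first tree triples are
    removed. *)
Definition forest_on W F : bool :=
  [&& all (tree_triple G) F,
      [forall v : 'I_n, count (fun t => v \in verts (tree_of t)) F == (v \in W)] &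
      sorted ltn [seq min_vert (tree_of t) | t <- F]].

Definition forest_perm F : seq 'I_n := flatten [seq tree_list (tree_of t) | t <- F].

Lemma tree_triple_decreasing t : tree_triple G t -> decreasing_subtree G (tree_of t).
Proof. by case/and4P. Qed.

Lemma exists_min_vert T : verts T != set0 ->
  exists m : 'I_n, [/\ m \in verts T, min_vert T = m & {in verts T, forall u, m <= u}].
Proof.
move=> /set0Pn[v0 v0T].
have [m mT mmin] := arg_minnP (fun u : 'I_n => u : nat) v0T.
exists m; split=> //; have := take1_enum mT mmin.
by rewrite /min_vert; case: (enum _) => [|c s] //= [->].
Qed.

Lemma decreasing_verts T : decreasing_subtree G T -> verts T != set0.
Proof. by case/and3P=> _ /and3P[]. Qed.

Lemma tree_list_perm T : decreasing_subtree G T -> perm_eq (tree_list T) (enum (verts T)).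
Proof.
move=> dT; have [m [mT _ mmin]] := exists_min_vert (decreasing_verts dT).
have [_ lT uT _] := decreasing_subtree_good Gsym Girr dT mT mmin.
apply: uniq_perm; rewrite ?enum_uniq -?(rev_uniq (tree_list T)) // => v.
by rewrite -mem_rev lT mem_enum.
Qed.

Lemma forest_count W F v : forest_on W F ->
  count (fun t => v \in verts (tree_of t)) F = (v \in W).
Proof. by case/and3P=> _ /forallP/(_ v)/eqP. Qed.

Lemma forest_perm_enum W F : forest_on W F -> perm_eq (forest_perm F) (enum W).
Proof.
move=> fF; apply/allP=> v _ /=; apply/eqP.
rewrite [RHS]count_uniq_mem ?enum_uniq // mem_enum -(forest_count v fF).
case/and3P: fF => + _ _; rewrite /forest_perm; elim: F => [|t F IHF] //= /andP[tT /IHF{}IHF].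
rewrite count_cat IHF; congr (_ + _).
rewrite (permP (tree_list_perm (tree_triple_decreasing tT))).
by rewrite count_uniq_mem ?enum_uniq // mem_enum.
Qed.

Lemma forest_on_nil W : forest_on W [::] = (W == set0).
Proof.
rewrite /forest_on /= andbT; apply/forallP/eqP => [W0|-> v]; last by rewrite inE.
by apply/setP=> v; have := W0 v; rewrite inE; case: (v \in W).
Qed.

Lemma forest_on0 t F : forest_on set0 (t :: F) = false.
Proof.
apply/negP=> fF; case/and3P: (fF) => /andP[/tree_triple_decreasing/decreasing_verts + _] _ _.
by move=> /set0Pn[v vT]; have := forest_count v fF; rewrite /= vT inE.
Qed.

(** A later tree containing the least vertex [x] would have a minimum not above that of the first
    tree, against the order of the minima. *)
Lemma forest_on_cons t F x W : x \notin W -> {in W, forall u, x < u} ->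
  forest_on (x |: W) (t :: F) =
  [&& tree_triple G t, x \in verts (tree_of t), verts (tree_of t) \subset x |: W &
      forest_on ((x |: W) :\: verts (tree_of t)) F].
Proof.
move=> xW ltxW; set V := verts (tree_of t).
have xmin u : u \in x |: W -> x <= u by move=> /setU1P[->|/ltxW/ltnW].
apply/idP/and4P => [fF|[tT xV VW fF]].
  have cF v := forest_count v fF; move/and3P: fF => [/andP[tT aF] _ srt].
  have VW : V \subset x |: W.
    by apply/subsetP=> v vV; have := cF v; rewrite /= vV; case: (v \in _).
  have fF : forest_on ((x |: W) :\: V) F.
    apply/and3P; split=> //; last exact: path_sorted srt.
    apply/forallP=> v; have := cF v; rewrite /= -/V in_setD; case vV: (v \in V); last by rewrite add0n => /eqP.
    by rewrite (subsetP VW v vV) add1n => -[/eqP].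
  split=> //; apply/negPn/negP=> xV.
  have := forest_count x fF; rewrite inE xV setU11 => cx.
  have /hasP[t' t'F xt'] : has (fun t => x \in verts (tree_of t)) F by rewrite has_count cx.
  have [m [mV mE _]] := exists_min_vert (decreasing_verts (tree_triple_decreasing tT)).
  have tT' := allP aF _ t'F.
  have [m' [mV' mE' m'min]] := exists_min_vert (decreasing_verts (tree_triple_decreasing tT')).
  have : all (fun k => m < k) [seq min_vert (tree_of t) | t <- F].
    by rewrite -mE; apply: order_path_min srt => ? ? ?; apply: ltn_trans.
  move=> /allP/(_ m')/=; rewrite -mE' (map_f (fun t => min_vert (tree_of t)) t'F) mE' => /(_ isT).
  by rewrite ltnNge (leq_trans (m'min x xt')) // xmin // (subsetP VW).
have cF v := forest_count v fF; move/and3P: fF => [aF _ srt].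
apply/and3P; split; first by rewrite /= tT.
  apply/forallP=> v; rewrite /= cF in_setD -/V.
  by case vV: (v \in V) => //=; rewrite (subsetP VW).
have [m [mV mE mmin]] := exists_min_vert (decreasing_verts (tree_triple_decreasing tT)).
have mx : m = x by apply: val_inj; apply: anti_leq; rewrite mmin // xmin // (subsetP VW).
rewrite /= path_sortedE; last by move=> ? ? ?; apply: ltn_trans.
rewrite srt andbT; apply/allP=> _ /mapP[t' t'F ->]; rewrite mE mx.
have [m' [mV' -> _]] := exists_min_vert (decreasing_verts (tree_triple_decreasing (allP aF _ t'F))).
have : 0 < count (fun t => m' \in verts (tree_of t)) F.
  by rewrite -has_count; apply/hasP; exists t'.
rewrite cF in_setD in_setU1; case: eqP => [->|_ /=]; first by rewrite -/V xV.
by case: (boolP (m' \in W)) => [/ltxW //|]; rewrite andbF.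
Qed.

Variables (A : comNzRingType) (q : A) (e : nat -> A).
Local Open Scope ring_scope.

Definition forest_term F : A :=
  (-1) ^+ (\sum_(t <- F) (size (comp_of t)).-1)%N
  * q ^+ (ninv G (forest_perm F) + \sum_(t <- F) (r_of t).-1)%N
  * \prod_(a <- flatten [seq comp_of t | t <- F]) e a.

Definition forest_sum k W : A :=
  \sum_(F : {bseq k of pretriple n}) if forest_on W F then forest_term F else 0.

Definition triple_term t : A :=
  (-1) ^+ (size (comp_of t)).-1
  * q ^+ (ninv G (tree_list (tree_of t)) + (r_of t).-1)%N
  * \prod_(a <- comp_of t) e a.

(** The inversions between the first list and the later ones depend only on the two vertex sets,
    since the lists enumerate these sets. *)
Lemma forest_term_cons M t F : decreasing_subtree G (tree_of t) -> forest_on M F ->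
  forest_term (t :: F) =
  triple_term t * q ^+ cross_inv G (verts (tree_of t)) M * forest_term F.
Proof.
move=> dT fF; rewrite /forest_term /triple_term !big_cons /= big_cat /=.
rewrite -[forest_perm (t :: F)]/(tree_list (tree_of t) ++ forest_perm F) ninv_cat.
have -> : (\sum_(a <- tree_list (tree_of t))
    count (fun b => (b < a)%N && G b a) (forest_perm F) = cross_inv G (verts (tree_of t)) M)%N.
  rewrite (perm_big _ (tree_list_perm dT)) big_enum /=; apply: eq_bigr => a _.
  rewrite (permP (forest_perm_enum fF)) -size_filter.
  rewrite -(card_uniqP (filter_uniq _ (enum_uniq _))); apply: eq_card => b.
  by rewrite mem_filter mem_enum !inE andbC.
have E (s1 s2 i1 i2 c r1 r2 p1 p2 : A) : s1 * s2 * (i1 * i2 * c * (r1 * r2)) * (p1 * p2)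
    = s1 * (i1 * r1) * p1 * c * (s2 * (i2 * r2) * p2) by ring.
by rewrite !exprD E.
Qed.

Lemma sum_r_of h : (h <= n)%N ->
  \sum_(r : 'I_n.+1 | (1 <= r <= h)%N) q ^+ r.-1 = qnum q h.
Proof.
move=> hn; rewrite -(big_mkord (fun r => 1 <= r <= h)%N (fun r => q ^+ r.-1)).
rewrite big_ltn_cond // (big_cat_nat _ (n := h.+1)) //= [X in _ + X]big1_seq ?addr0.
  rewrite big_add1 /= big_nat_cond /qnum -(big_mkord xpredT (fun r => q ^+ r)).
  by rewrite [RHS]big_nat_cond; apply: eq_bigl => r; case: (r < h)%N.
move=> r /andP[/andP[_ rh]]; rewrite mem_index_iota => /andP[hr _].
by rewrite ltnNge rh in hr.
Qed.

(** For a fixed tree, summing over [r] produces the factor [qnum] of the first part, and summing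
    over the composition then produces [csum]. *)
Lemma sum_triples (P : pred (pregraph n)) (g : pregraph n -> A) :
  \sum_(t : pretriple n | tree_triple G t && P (tree_of t)) triple_term t * g (tree_of t) =
  \sum_(T : pregraph n | decreasing_subtree G T && P T)
     q ^+ Defs.inv G (tree_list T) * csum q e #|verts T| * g T.
Proof.
transitivity (\sum_(T : pregraph n) \sum_(c : {bseq n of 'I_n.+1}) \sum_(r : 'I_n.+1)
   if tree_triple G (T, c, r) && P T then triple_term (T, c, r) * g T else 0).
  rewrite pair_bigA pair_bigA /= big_mkcond /=; apply: eq_bigr => -[[T c] r] _ /=.
  by [].
rewrite [RHS]big_mkcond; apply: eq_bigr => T _; rewrite /tree_triple /=.
case dT: (decreasing_subtree G T) => /=; last first.
  by rewrite big1 // => c _; rewrite big1.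
case PT: (P T); last first.
  by rewrite big1 // => c _; rewrite big1 // => r _; rewrite andbF.
have VT : (#|verts T| <= n)%N by rewrite -[leqRHS]card_ord max_card.
rewrite -(csumE q e VT VT) /comp_sum [RHS]mulrAC big_distrr /=.
apply: eq_bigr => c _; rewrite /comp_term /is_comp /triple_term inv_ninv.
rewrite -[map val c]/(comp_of (T, c, ord0)) /comp_of /=.
case: ifP => [/andP[all1 sumc]|/negbT]; last first.
  rewrite negb_and => nc; rewrite mulr0 big1 // => r _.
  by case: ifP => // /andP[/and3P[a1 s1 _] _]; rewrite a1 s1 in nc.
have hn : (head 0%N (map val c) <= n)%N.
  by case: (val c) => [|a ?] //=; rewrite -ltnS ltn_ord.
rewrite -(sum_r_of hn) big_distrr !big_distrl big_distrr /= [RHS]big_mkcond /=.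
apply: eq_bigr => r _; rewrite all1 sumc /= andbT /r_of /=.
have E (s i r' p' g' : A) : s * (i * r') * p' * g' = i * g' * (s * r' * p') by ring.
by case: ifP => // _; rewrite size_map exprD E.
Qed.

Lemma forest_sumS k x W : x \notin W -> {in W, forall u, (x < u)%N} ->
  forest_sum k.+1 (x |: W) = \sum_(R : {set 'I_n} | R \subset W)
    block_weight G q x R * csum q e #|R|.+1 * q ^+ cross_inv G (x |: R) (W :\: R)
    * forest_sum k (W :\: R).
Proof.
move=> xW ltxW; rewrite /forest_sum.
rewrite (big_bseq_cons _ (fun F => if forest_on (x |: W) F then forest_term F else 0)).
rewrite forest_on_nil; have /negPf-> : x |: W != set0.
  by apply/set0Pn; exists x; rewrite setU11.
rewrite add0r.
pose P T := (x \in verts T) && (verts T \subset x |: W).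
pose g T := q ^+ cross_inv G (verts T) ((x |: W) :\: verts T)
  * forest_sum k ((x |: W) :\: verts T).
transitivity (\sum_(t : pretriple n | tree_triple G t && P (tree_of t)) triple_term t * g (tree_of t)).
  rewrite [RHS]big_mkcond; apply: eq_bigr => t _.
  under eq_bigr do rewrite forest_on_cons //.
  case: ifP => [/andP[tT /andP[xT sT]]|nP]; last first.
    rewrite big1 // => F _; case: ifP => // /and4P[tT xT sT _].
    by rewrite tT /P xT sT in nP.
  rewrite tT xT sT /= /g /forest_sum mulrA big_distrr /=; apply: eq_bigr => F _.
  case: ifP => fF; last by rewrite mulr0.
  by rewrite (forest_term_cons (tree_triple_decreasing tT) fF).
rewrite sum_triples.
rewrite (partition_big (fun T => verts T :\ x) (fun R => R \subset W)) /=; last first.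
  move=> T /and3P[_ xT]; rewrite -(setU1K xW) => /(setSD [set x]).
  by rewrite !setU1K // !inE eqxx.
apply: eq_bigr => R RW.
have xR : x \notin R by apply: contra xW => /(subsetP RW).
have ltxR : {in x |: R, forall u, (x <= u)%N}.
  by move=> u /setU1P[->//|/(subsetP RW)/ltxW/ltnW].
have := sum_decreasing_subtrees Gsym Girr Gnui q (setU11 x R) ltxR.
rewrite setU1K // => <-; rewrite !big_distrl /=.
apply: eq_big => [T|T /andP[/and3P[_ xT _] /eqP TR']].
  rewrite -andbA; congr (_ && _); rewrite /P; apply/andP/eqP => [[/andP[xT _] /eqP <-]|->].
    by rewrite setD1K.
  by rewrite setU11 setUS // setU1K.
have TR : verts T = x |: R by rewrite -TR' setD1K.
have -> : #|R|.+1 = #|verts T| by rewrite TR cardsU1 xR.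
by rewrite /g TR -setDDl setU1K // mulrA.
Qed.

Lemma forest_sum0 k : forest_sum k set0 = 1.
Proof.
have nil : (if forest_on set0 [::] then forest_term [::] else 0) = 1.
  by rewrite forest_on_nil eqxx /forest_term /= !big_nil !expr0 !mulr1.
rewrite /forest_sum; case: k => [|k].
  by rewrite (big_bseq0 (fun F => if forest_on set0 F then forest_term F else 0)).
rewrite (big_bseq_cons _ (fun F => if forest_on set0 F then forest_term F else 0)) nil.
by rewrite big1 ?addr0 // => t _; rewrite big1 // => F _; rewrite forest_on0.
Qed.

(** Peeling off a tree lowers the bound on the number of trees, whereas [block_rec] asks for one
    function of [W]. As trees are nonempty, any bound from [#|W|] on gives the same sum. *)
Lemma forest_sum_stable k k' W : (#|W| <= k)%N -> (#|W| <= k')%N ->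
  forest_sum k W = forest_sum k' W.
Proof.
have [l] := ubnP #|W|; elim: l k k' W => // l IHl k k' W ltWl.
have [->|[v0 v0W]] := set_0Vmem W; first by rewrite !forest_sum0.
have [x xW xmin] := arg_minnP (fun u : 'I_n => u : nat) v0W.
rewrite -(setD1K xW) in ltWl *.
have xW' : x \notin W :\ x by rewrite !inE eqxx.
have ltxW : {in W :\ x, forall u, (x < u)%N}.
  by move=> u /setD1P[ux uW]; rewrite ltn_neqAle eq_sym ux; apply: xmin.
move: ltWl; rewrite cardsU1 xW' add1n ltnS.
case: k k' => [|k] [|k'] // ltWl kW kW'; rewrite !forest_sumS //.
apply: eq_bigr => R RW; congr (_ * _).
have WR : (#|(W :\ x) :\: R| <= #|W :\ x|)%N by rewrite subset_leq_card ?subsetDl.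
by apply: IHl; apply: leq_ltn_trans WR _ || apply: leq_trans WR _.
Qed.

Theorem forest_rec : block_rec G q (csum q e) (forest_sum n).
Proof.
split=> [|x W xW ltxW]; first exact: forest_sum0.
have n0 : (0 < n)%N by apply: leq_ltn_trans (ltn_ord x).
have -> : forest_sum n (x |: W) = forest_sum n.-1.+1 (x |: W) by rewrite (prednK n0).
rewrite forest_sumS //; apply: eq_bigr => R RW.
congr (_ * _); apply: forest_sum_stable; last by rewrite -[leqRHS]card_ord max_card.
rewrite -ltnS (prednK n0) -[ltnRHS]card_ord; apply: proper_card.
rewrite properE subset_predT; apply/subsetPn; exists x => //.
by rewrite inE (negPf xW) andbF.
Qed.

End ForestSums.

(** * Colourings of a set of vertices with the first [j] colours *)

Section ColouringSums.
Local Open Scope ring_scope.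
Variables (n : nat) (G : rel 'I_n).
Hypotheses (Gsym : symmetric G) (Girr : irreflexive G)
  (Gnui : natural_unit_interval G).
Implicit Types (u v w x : 'I_n) (S W : {set 'I_n}).
Variables (A : comNzRingType) (q : A) (N : nat) (y : nat -> A).
Implicit Types (k : {ffun 'I_n -> 'I_N.+1}).

(* Vertices outside [W] get the value 0, and colour [c] is encoded as [c.+1]. *)
Definition partial_colouring j W k : bool :=
  [forall v, if v \in W then (0 < k v <= j)%N else k v == ord0] &&
  [forall u in W, forall v, G u v ==> (k u != k v)].

Definition partial_asc W k : nat :=
  \sum_(u in W) #|[set w in lower_nbrs G W u | (k w < k u)%N]|.

Definition colour_sum j W : A :=
  \sum_(k | partial_colouring j W k) q ^+ partial_asc W k * \prod_(v in W) y (k v).-1.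

Lemma partial_colouringP j W k : reflect
  [/\ forall v, v \in W -> (0 < k v <= j)%N, forall v, v \notin W -> k v = ord0 &
      forall u v, u \in W -> G u v -> k u != k v]
  (partial_colouring j W k).
Proof.
apply: (iffP andP) => [[/forallP H1 /forall_inP H2]|[H1 H2 H3]]; split.
- by move=> v vW; have := H1 v; rewrite vW.
- by move=> v /negPf vW; have := H1 v; rewrite vW => /eqP.
- by move=> u v uW Guv; have /forallP/(_ v) := H2 u uW; rewrite Guv.
- by apply/forallP=> v; case: ifPn => [/H1|/H2->].
- by apply/forall_inP=> u uW; apply/forallP=> v; apply/implyP; apply: H3.
Qed.

Definition add_class S (c : 'I_N.+1) k : {ffun 'I_n -> 'I_N.+1} :=
  [ffun v => if v \in S then c else k v].

(** [S] is the class of the new largest colour. Each of its vertices has an ascent from every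
    smaller neighbour in [W :\: S], while the vertices of [W :\: S] have no ascent from [S]. *)
Lemma colour_sumS j W : (j < N)%N ->
  colour_sum j.+1 W = \sum_(S : {set 'I_n} | S \subset W)
    if indep G S then
      y j ^+ #|S| * q ^+ cross_inv G S (W :\: S) * colour_sum j (W :\: S) else 0.
Proof.
move=> jN; pose c : 'I_N.+1 := inord j.+1.
have cE : c = j.+1 :> nat by rewrite inordK.
rewrite -big_mkcondr /= /colour_sum.
rewrite (partition_big (fun k => [set v | k v == c]) (fun S => (S \subset W) && indep G S)) /=; last first.
  move=> k /partial_colouringP[kW k0 kG]; apply/andP; split.
    apply/subsetP=> v; rewrite inE => /eqP kv; apply: contraT => /k0 E.
    by move: cE; rewrite -kv E.
  have mW v : k v == c -> v \in W.
    by move=> /eqP kv; apply: contraT => /k0 E; move: cE; rewrite -kv E.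
  apply/indepP=> u v; rewrite !inE => uc vc; apply/negP=> /(kG u v (mW u uc)).
  by rewrite (eqP uc) (eqP vc) eqxx.
apply: eq_bigr => S /andP[SW /indepP iS].
rewrite (reindex_onto (add_class S c) (add_class S ord0)) /=; last first.
  move=> k /andP[_ /eqP SE]; apply/ffunP=> v; rewrite !ffunE -SE inE.
  by case: eqP => [->|].
have condE k : partial_colouring j.+1 W (add_class S c k) &&
    ([set v | add_class S c k v == c] == S) && (add_class S ord0 (add_class S c k) == k)
    = partial_colouring j (W :\: S) k.
  apply/andP/partial_colouringP => [[/andP[/partial_colouringP[kW k0 kG] /eqP SE] /eqP kE]|[kW k0 kG]].
    have kS v : v \in S -> k v = ord0 by move=> vS; rewrite -kE ffunE vS.
    have cS v : v \notin S -> k v != c.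
      by move=> vS; move: (vS); rewrite -{1}SE inE ffunE (negPf vS).
    split.
    + move=> v /setDP[vW vS]; have := kW v vW; rewrite ffunE (negPf vS) => /andP[-> le].
      rewrite /= -ltnS ltn_neqAle le andbT -cE.
      by apply: contra (cS v vS) => /eqP E; apply/eqP/val_inj.
    + move=> v; rewrite inE negb_and negbK; case: (boolP (v \in S)) => [/kS //|vS /= vW].
      by have := k0 v vW; rewrite ffunE (negPf vS).
    + move=> u v /setDP[uW uS] Guv; have := kG u v uW Guv.
      rewrite !ffunE (negPf uS); case: (boolP (v \in S)) => [/kS->|//].
      move=> _; have := kW u uW; rewrite ffunE (negPf uS) => /andP[+ _].
      by rewrite lt0n.
  have kS v : v \in S -> k v = ord0 by move=> vS; apply: k0; rewrite inE vS.
  have kc v : k v != c.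
    case: (boolP (v \in W :\: S)) => [/kW /andP[_ le]|/k0 ->].
      by apply: contraTneq le => ->; rewrite cE ltnn.
    by apply: contra_neq (_ : c != ord0) => [<- //|]; rewrite -val_eqE /= cE.
  split; last first.
    by apply/eqP/ffunP=> v; rewrite !ffunE; case: (boolP (v \in S)) => [/kS->|].
  apply/andP; split; last first.
    apply/eqP/setP=> v; rewrite inE ffunE; case: ifP => vS; first by rewrite eqxx.
    exact/negbTE.
  apply/partial_colouringP; split.
  + move=> v vW; rewrite ffunE; case: (boolP (v \in S)) => vS; first by rewrite cE ltnSn.
    by have /andP[-> le] : (0 < k v <= j)%N; [apply: kW; rewrite inE vS | rewrite ltnW].
  + move=> v vW; rewrite ffunE ifN; last by apply: contra vW => /(subsetP SW).
    by apply: k0; rewrite inE negb_and vW orbT.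
  + move=> u v uW Guv; rewrite !ffunE.
    case: (boolP (u \in S)) => uS; case: (boolP (v \in S)) => vS //.
    * by have := iS u v uS vS; rewrite Guv.
    * by rewrite eq_sym.
    * by apply: kG; rewrite // inE uS.
rewrite (eq_bigl _ _ condE) big_distrr /=; apply: eq_bigr => k /partial_colouringP[kW k0 kG].
have disS : [disjoint S & W :\: S].
  by rewrite disjoint_sym -setI_eq0 setIDAC setDIl setDv setI0.
have glue : S :|: (W :\: S) = W by rewrite -{1}(setIidPr SW) setID.
have ksm v : v \notin S -> (k v < c)%N.
  move=> vS; rewrite cE ltnS; case: (boolP (v \in W :\: S)) => [/kW/andP[]//|/k0->].
  by [].
have ascE : partial_asc W (add_class S c k) =
    (cross_inv G S (W :\: S) + partial_asc (W :\: S) k)%N.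
  rewrite /partial_asc -{1}glue.
  rewrite (eq_bigl [predU S & W :\: S]); last by move=> v; rewrite !inE.
  rewrite bigU //=; congr (_ + _)%N; apply: eq_bigr => u uS.
    apply: eq_card => w; rewrite !inE !ffunE uS.
    case: (boolP (w \in S)) => wS; first by rewrite ltnn andbF.
    by rewrite ksm // andbT.
  move/setDP: uS => [uW uS].
  apply: eq_card => w; rewrite !inE !ffunE (negPf uS).
  case: (boolP (w \in S)) => wS //=.
  by rewrite [(c < _)%N]ltnNge (ltnW (ksm u uS)) !andbF.
have prodE : \prod_(v in W) y (add_class S c k v).-1 =
    y j ^+ #|S| * \prod_(v in W :\: S) y (k v).-1.
  rewrite -{1}glue (eq_bigl [predU S & W :\: S]); last by move=> v; rewrite !inE.
  rewrite bigU //=; congr (_ * _).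
    by rewrite -prodr_const; apply: eq_bigr => v vS; rewrite ffunE vS cE.
  by apply: eq_bigr => v /setDP[_ vS]; rewrite ffunE (negPf vS).
have E (a b d f : A) : a * b * (d * f) = d * a * (b * f) by ring.
by rewrite ascE prodE exprD E.
Qed.

Lemma colour_sum_0 W : colour_sum 0 W = (W == set0)%:R.
Proof.
rewrite /colour_sum; case: eqP => [->|/eqP/set0Pn[v vW]]; last first.
  rewrite big_pred0 // => k; apply/partial_colouringP=> -[/(_ v vW)].
  by case: (nat_of_ord (k v)).
rewrite (big_pred1 [ffun _ => ord0]) => [|k].
  by rewrite /partial_asc !big_set0 expr0 mulr1.
apply/partial_colouringP/eqP => [[_ k0 _]|->].
  by apply/ffunP=> v; rewrite ffunE k0 // inE.
by split=> [v|v _|u v]; rewrite ?inE ?ffunE.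
Qed.

(* [e j] are the elementary symmetric functions of [y 0, ..., y j.-1]. *)
Theorem colour_rec (e : nat -> nat -> A) :
  (forall j, e j 0%N = 1) -> (forall i, e 0%N i.+1 = 0) ->
  (forall j i, (j < N)%N -> e j.+1 i.+1 = e j i.+1 + y j * e j i) ->
  forall j, (j <= N)%N -> block_rec G q (csum q (e j)) (colour_sum j).
Proof.
move=> ej0 e0S eS; elim=> [_|j IHj jN].
  split=> [|x W xW ltxW]; first by rewrite colour_sum_0 eqxx.
  rewrite colour_sum_0 -[_ == _]negbK.
  have -> : x |: W != set0 by apply/set0Pn; exists x; rewrite setU11.
  (* Without variables E(t) = 1, so all Q_i vanish, in accordance with the lack of colourings of a
     nonempty set. *)
  have c0 i : csum q (e 0%N) i = 0.
    case: i => [|i]; first by rewrite /csum comp_sum0.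
    have := conv_csum q i.+1 (ej0 0%N).
    rewrite /conv big_ord_recl ej0 mul1r subn0 e0S mulr0 big1 ?addr0 // => l _.
    by rewrite /= /bump leq0n add1n e0S mul0r.
  by rewrite big1 // => R _; rewrite c0 mulr0 !mul0r.
have [Q1 QS] := csum_adjoin q (ej0 j) (ej0 j.+1) (fun i => eS j i jN).
apply: (block_rec_step Gsym Girr Gnui Q1 QS (IHj (ltnW jN))) => W.
exact: colour_sumS.
Qed.

End ColouringSums.

(** * All colours and all vertices: equality in finitely many variables *)

Section FullSums.
Local Open Scope ring_scope.
Variables (n : nat) (G : rel 'I_n).
Hypotheses (Gsym : symmetric G) (Girr : irreflexive G)
  (Gnui : natural_unit_interval G).
Variables (A : comNzRingType) (q : A) (M : nat) (y : 'I_M.+1 -> A).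
Implicit Types (h S U : {set 'I_M.+1}).

(** The elementary symmetric function in the first [j] variables, summed over subsets of a fixed
    ['I_M.+1] so that all [j] share one index type. *)
Definition elsym (j k : nat) : A :=
  \sum_(h : {set 'I_M.+1} | h \subset [set i : 'I_M.+1 | (i < j)%N])
    if #|h| == k then \prod_(i in h) y i else 0.

Lemma elsym_0 j : elsym j 0 = 1.
Proof.
rewrite /elsym (bigD1 set0) ?sub0set //= cards0 eqxx big_set0 big1 ?addr0 // => h /andP[_ h0].
by rewrite cards_eq0 (negPf h0).
Qed.

Lemma elsym_0S k : elsym 0 k.+1 = 0.
Proof.
rewrite /elsym big1 // => h; have -> : [set i : 'I_M.+1 | (i < 0)%N] = set0.
  by apply/setP=> i; rewrite !inE.
by rewrite subset0 => /eqP->; rewrite cards0.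
Qed.

Lemma elsymS j k : (j < M.+1)%N -> elsym j.+1 k.+1 = elsym j k.+1 + y (inord j) * elsym j k.
Proof.
move=> jM; have jE : inord j = j :> nat := inordK jM.
have jU : inord j \notin [set i : 'I_M.+1 | (i < j)%N] by rewrite inE jE ltnn.
have UE : [set i : 'I_M.+1 | (i < j.+1)%N] = inord j |: [set i : 'I_M.+1 | (i < j)%N].
  by apply/setP=> i; rewrite !inE ltnS leq_eqVlt -val_eqE /= jE.
rewrite {1}/elsym UE sum_subset_setU1 //; congr (_ + _).
rewrite /elsym big_distrr; apply: eq_bigr => h hU /=.
have jh : inord j \notin h by apply: contra jU => /(subsetP hU).
rewrite cardsU1 jh add1n eqSS; case: ifP => _; last by rewrite mulr0.
by rewrite big_setU1.
Qed.

Lemma elsym_full k : elsym M.+1 k =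
  \sum_(h : {set 'I_M.+1} | #|h| == k) \prod_(i in h) y i.
Proof.
rewrite [RHS]big_mkcond; apply: eq_bigl => h.
by apply/subsetP=> i _; rewrite inE.
Qed.

Let yn (c : nat) : A := y (inord c).

(** [up] and [down] shift colours by one, since [colour_sum] reserves the value 0 for uncoloured
    vertices. *)
Lemma colour_sum_full : colour_sum G q M.+1 yn M.+1 setT =
  \sum_(kappa : {ffun 'I_n -> 'I_M.+1} | proper_colouring G (fun i => kappa i))
     q ^+ asc G (fun i => kappa i) * \prod_(v : 'I_n) y (kappa v).
Proof.
pose up (kappa : {ffun 'I_n -> 'I_M.+1}) : {ffun 'I_n -> 'I_M.+2} :=
  [ffun v => lift ord0 (kappa v)].
pose down (k : {ffun 'I_n -> 'I_M.+2}) : {ffun 'I_n -> 'I_M.+1} :=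
  [ffun v => inord (k v).-1].
have upE kappa v : up kappa v = (kappa v).+1 :> nat by rewrite ffunE.
rewrite /colour_sum (reindex_onto up down) /=; last first.
  move=> k /partial_colouringP[kT _ _]; apply/ffunP=> v; apply: val_inj.
  have /andP[k0 kM] := kT v (in_setT v).
  by rewrite /= upE ffunE inordK; rewrite (prednK k0).
apply: eq_big => [kappa|kappa _].
  have -> : down (up kappa) == kappa.
    by apply/eqP/ffunP=> v; rewrite ffunE upE inord_val.
  rewrite andbT; apply/partial_colouringP/forallP => [[_ _ H] i|H].
    apply/forallP=> j; apply/implyP=> /(H i j (in_setT i)).
    by rewrite -val_eqE /= !upE eqSS.
  split=> [v _|v|u v _ Guv]; rewrite ?upE ?ltn_ord ?inE //.
  have /forallP/(_ v)/implyP/(_ Guv) := H u.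
  by rewrite -val_eqE /= !upE eqSS.
congr (_ * _).
  congr (_ ^+ _); rewrite /partial_asc.
  have -> : asc G (fun i => kappa i) = (\sum_(w : 'I_n) \sum_(u : 'I_n)
      [&& w < u, G w u & kappa w < kappa u] : nat)%N.
    rewrite /asc -sum1_card big_mkcond pair_bigA /=; apply: eq_bigr => -[w u] _.
    by rewrite inE /=; case: ifP.
  rewrite [RHS]exchange_big /=; apply: eq_big => [u|u _]; first by rewrite inE.
  rewrite -sum1_card big_mkcond /=; apply: eq_bigr => w _.
  by rewrite !inE !upE ltnS; case: (w < u)%N; case: (G w u); case: (kappa w < kappa u)%N.
apply: eq_big => [v|v _]; first by rewrite inE.
by rewrite /yn upE inord_val.
Qed.

Theorem colourings_forests :
  \sum_(kappa : {ffun 'I_n -> 'I_M.+1} | proper_colouring G (fun i => kappa i))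
     q ^+ asc G (fun i => kappa i) * \prod_(v : 'I_n) y (kappa v) =
  \sum_(F in FT G) forest_term G q (elsym M.+1) F.
Proof.
rewrite -colour_sum_full.
have rec := @colour_rec n G Gsym Girr Gnui A q M.+1 yn elsym elsym_0 elsym_0S
  (fun j k jM => elsymS k jM) M.+1 (leqnn _).
rewrite (block_rec_unique rec (forest_rec Gsym Girr Gnui q _)).
rewrite /forest_sum [RHS]big_mkcond; apply: eq_bigr => F _.
rewrite inE; congr (if _ then _ else _).
rewrite /forest_on /forest_triple; congr [&& _, _ & _].
by apply: eq_forallb => v; rewrite inE.
Qed.

End FullSums.

(** Objects with values in [finsupp m] and objects with values in ['I_N] can be compared only
    through their underlying natural numbers, that is, through injections into a common type [K]. *)
Lemma big_transfer (A : nmodType) (I1 I2 : finType) (K : eqType) (f1 : I1 -> K) (f2 : I2 -> K)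
    (P1 : pred I1) (P2 : pred I2) (F1 : I1 -> A) (F2 : I2 -> A) :
  injective f1 -> injective f2 ->
  (forall i, P1 i -> exists2 j, P2 j & f2 j = f1 i) ->
  (forall j, P2 j -> exists2 i, P1 i & f1 i = f2 j) ->
  (forall i j, P1 i -> P2 j -> f1 i = f2 j -> F1 i = F2 j) ->
  (\sum_(i | P1 i) F1 i = \sum_(j | P2 j) F2 j)%R.
Proof.
move=> inj1 inj2 P12 P21 FE.
transitivity (\sum_(i | P1 i) \sum_(j | P2 j && (f2 j == f1 i)) F2 j)%R.
  apply: eq_bigr => i Pi; have [j Pj ji] := P12 i Pi.
  rewrite (big_pred1 j); first exact: FE.
  by move=> j' /=; rewrite -ji (inj_eq inj2); case: eqP => [->|]; rewrite ?Pj ?andbF.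
rewrite (exchange_big_dep P2) /=; last by move=> i j _ /andP[].
apply: eq_bigr => j Pj; have [i Pi ij] := P21 j Pj.
rewrite (big_pred1 i) // => i' /=.
by rewrite Pj -ij (inj_eq inj1) eq_sym; case: eqP => [->|]; rewrite ?Pi ?andbF.
Qed.

Lemma eq_proper_colouring n (G : rel 'I_n) (k1 k2 : 'I_n -> nat) :
  k1 =1 k2 -> proper_colouring G k1 = proper_colouring G k2.
Proof. by move=> E; apply: eq_forallb => i; apply: eq_forallb => j; rewrite !E. Qed.

Lemma eq_asc n (G : rel 'I_n) (k1 k2 : 'I_n -> nat) : k1 =1 k2 -> asc G k1 = asc G k2.
Proof. by move=> E; apply: eq_card => p; rewrite !inE !E. Qed.

(** * Reading coefficients of series off polynomials in [N] variables *)

Section Coefficients.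
Import mpoly.
Local Open Scope ring_scope.
Variable N : nat.
Local Notation R := {poly int}.
Implicit Types (m a : {mset nat}%mset) (f g : series) (p : {mpoly R[N]}).

Definition supported m : Prop := forall c : nat, (N <= c)%N -> m c = 0%N.

Definition mnm_of m : 'X_{1..N} := [multinom m i | i < N].

(** Agreement on the monomials in the first [N] variables. Each monomial is of this kind for large
    [N], so an identity of series reduces to identities of polynomials. *)
Definition represents f p : Prop := forall m, supported m -> f m = p@_(mnm_of m).

Lemma mnm_of_inj m a : supported m -> supported a -> mnm_of m = mnm_of a -> m = a.
Proof.
move=> sm sa E; apply/msetP=> c; case: (ltnP c N) => cN; last by rewrite sm ?sa.
by move/mnmP/(_ (Ordinal cN)): E; rewrite !mnmE.
Qed.

Definition mset_of (h : 'X_{1..N}) : {mset nat}%mset :=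
  seq_mset (flatten [seq nseq (h i) (val i) | i <- enum 'I_N]).

Lemma mset_of_supported h : supported (mset_of h).
Proof.
move=> c cN; rewrite mset_seqE; apply/count_memPn/negP=> /flatten_mapP[i _].
by rewrite mem_nseq => /andP[_ /eqP E]; have := ltn_ord i; rewrite ltnNge -E cN.
Qed.

Lemma mset_ofK h : mnm_of (mset_of h) = h.
Proof.
apply/mnmP=> i; rewrite mnmE mset_seqE count_flatten -map_comp sumnE big_map big_enum /=.
rewrite (bigD1 i) //= count_nseq /= eqxx mul1n big1 ?addn0 // => j ji.
by rewrite count_nseq /= val_eqE (negPf ji) mul0n.
Qed.

Lemma supported_sub m a : (a `<=` m)%mset -> supported m -> supported a.
Proof. by move=> /msubsetP am sm c cN; apply/eqP; rewrite -leqn0; apply: leq_trans (am c) _; rewrite sm. Qed.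

Lemma represents1 : represents series1 1.
Proof.
move=> m sm; rewrite /series1 mcoeff1; congr ((nat_of_bool _)%:R).
apply/eqP/eqP => [->|E]; first by apply/mnmP=> i; rewrite !mnmE mset0E.
apply/msetP=> c; rewrite mset0E; case: (ltnP c N) => cN; last exact: sm.
by move/mnmP/(_ (Ordinal cN)): E; rewrite !mnmE.
Qed.

(** Divisors of a monomial in the first [N] variables are again monomials in these variables, so
    both products run over the same factorisations. *)
Lemma represents_mul f g p1 p2 : represents f p1 -> represents g p2 ->
  represents (series_mul f g) (p1 * p2).
Proof.
move=> fp gp m sm.
rewrite [RHS](mcoeff_poly_mul_lin _ _ (k := (mdeg (mnm_of m)).+1)) //.
transitivity (\sum_(h <- [seq mnm_of a | a <- divisors_mset m])
    p1@_h * p2@_(mnm_of m - h)%MM).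
  rewrite big_map /series_mul; apply: eq_big_seq => a; rewrite mem_divisors_mset => am.
  rewrite fp ?gp; first 1 last.
  - by apply: supported_sub sm; apply/msubsetP=> c; rewrite msetE2 leq_subr.
  - exact: supported_sub sm.
  by congr (_ * _@__); apply/mnmP=> i; rewrite !mnmE msetE2.
(* Divisors of [m] satisfy the degree bound of this index type, so [L] lists exactly their
   exponents. *)
pose L := [seq bmnm h | h <- [seq h <- index_enum 'X_{1..N < (mdeg (mnm_of m)).+1} |
   (bmnm h <= mnm_of m)%MM]].
transitivity (\sum_(h <- L) p1@_h * p2@_(mnm_of m - h)%MM); last first.
  by rewrite big_map big_filter.
apply: perm_big; apply: uniq_perm.
- rewrite map_inj_in_uniq ?undup_uniq // => a b; rewrite !mem_divisors_mset => am bm.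
  by apply: mnm_of_inj; apply: supported_sub sm.
- by rewrite map_inj_uniq ?filter_uniq ?index_enum_uniq //; apply: val_inj.
move=> h; apply/mapP/mapP => [[a]|[h']].
  rewrite mem_divisors_mset => /msubsetP am ->.
  have le : (mnm_of a <= mnm_of m)%MM by apply/mnm_lepP=> i; rewrite !mnmE.
  have lt : (mdeg (mnm_of a) < (mdeg (mnm_of m)).+1)%N 
    by rewrite ltnS !mdegE; apply: leq_sum => i _; rewrite !mnmE.
  by exists (BMultinom lt); rewrite // mem_filter le mem_index_enum.
rewrite mem_filter => /andP[/mnm_lepP le _] ->.
exists (mset_of (bmnm h')); last by rewrite mset_ofK.
rewrite mem_divisors_mset; apply/msubsetP=> c; case: (ltnP c N) => cN.
  by have := le (Ordinal cN); rewrite -{1}[bmnm h']mset_ofK !mnmE.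
by rewrite mset_of_supported.
Qed.

Lemma represents_prod (E : nat -> {mpoly R[N]}) (mu : seq nat) :
  (forall k, represents (elem_sym k) (E k)) ->
  represents (elem_sym_part mu) (\prod_(k <- mu) E k).
Proof.
move=> EP; rewrite /elem_sym_part; elim: mu => [|k mu IHmu] /=.
  by rewrite big_nil; apply: represents1.
by rewrite big_cons; apply: represents_mul.
Qed.

Lemma sum_mnm1 m (s : seq 'I_N) : supported m ->
  ((\sum_(i <- s) U_(i))%MM == mnm_of m) = (monomial (map val s) == m).
Proof.
move=> sm.
have cE (i : 'I_N) : (\sum_(i <- s) U_(i))%MM i = monomial (map val s) i.
  rewrite mset_seqE count_map mnm_sumE -sum1_count [RHS]big_mkcond /=.
  by apply: eq_bigr => j _; rewrite mnm1E val_eqE; case: eqP.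
apply/eqP/eqP => [E|E]; last by apply/mnmP=> i; rewrite cE E mnmE.
apply/msetP=> c; case: (ltnP c N) => cN.
  by rewrite -[c]/(val (Ordinal cN)) -cE E mnmE.
rewrite sm // mset_seqE; apply/count_memPn/negP=> /mapP[i _ ci].
by have := ltn_ord i; rewrite ltnNge -[nat_of_ord i]/(val i) -ci cN.
Qed.

Lemma prod_mcoeff (I : Type) (s : seq I) (k : I -> 'I_N) m : supported m ->
  (\prod_(i <- s) 'X_(k i) : {mpoly R[N]})@_(mnm_of m) =
  (monomial [seq val (k i) | i <- s] == m)%:R.
Proof.
move=> sm; rewrite mprodXE mcoeffX -(big_map k predT (fun i => U_(i)%MM)) sum_mnm1 //.
by rewrite -map_comp.
Qed.

Lemma monomial_supported_mem m (s : seq nat) c : supported m -> monomial s = m -> c \in s ->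
  (c < N)%N.
Proof.
move=> sm sE cs; rewrite ltnNge; apply/negP=> /sm.
by rewrite -sE mset_seqE => /count_memPn; rewrite cs.
Qed.

Lemma ord_ltn_sorted (h : {set 'I_N}) : sorted ltn [seq val i | i <- enum h].
Proof. by rewrite sorted_map; apply: enum_sorted. Qed.

Lemma seq_ord_ltn (s : seq nat) : (forall c, c \in s -> (c < N)%N) ->
  exists t : seq 'I_N, map val t = s.
Proof.
elim: s => [|c s IHs] H; first by exists [::].
have [|t tE] := IHs; first by move=> d ds; apply: H; rewrite inE ds orbT.
by exists (Ordinal (H c (mem_head _ _)) :: t); rewrite /= tE.
Qed.

(** A strictly increasing tuple is the enumeration of its set of entries. The condition that its
    monomial be [m] puts the entries both in [finsupp m] and below [N]. *)
Lemma represents_elem_sym k : represents (elem_sym k)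
  (\sum_(h : {set 'I_N} | #|h| == k) \prod_(i in h) 'X_i).
Proof.
move=> m sm; rewrite raddf_sum /=.
transitivity (\sum_(h : {set 'I_N} | (#|h| == k) &&
   (monomial [seq val i | i <- enum h] == m)) (1 : R)); last first.
  rewrite big_mkcondr; apply: eq_bigr => h _.
  rewrite -big_enum /= (prod_mcoeff (enum h) id sm).
  by case: ifP.
apply: (big_transfer (f1 := fun i : k.-tuple (finsupp m) => map val (val i))
          (f2 := fun h : {set 'I_N} => [seq val i | i <- enum h])) => //.
- move=> i j /= E; apply: val_inj => /=; move: E; apply: inj_map; exact: val_inj.
- move=> h1 h2 /= E.
  have E' : enum h1 = enum h2 by move: E; apply: inj_map; exact: val_inj.
  by apply/setP=> i; rewrite -[i \in h1]mem_enum E' mem_enum.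
- move=> i /andP[srt /eqP im].
  have [t tE] := seq_ord_ltn (fun c => monomial_supported_mem sm im).
  have ut : uniq t.
    rewrite -(map_inj_uniq val_inj) tE; apply: (sorted_uniq ltn_trans ltnn srt).
  have E : [seq val i | i <- enum [set j in t]] = map val (val i).
    apply: (irr_sorted_eq ltn_trans ltnn) => //; first exact: ord_ltn_sorted.
    by move=> c; rewrite -tE; apply/mapP/mapP => -[j]; rewrite ?mem_enum ?inE => jt ->;
      exists j; rewrite ?mem_enum ?inE.
  exists [set j in t]; rewrite // E im eqxx andbT.
  by rewrite cardsE (card_uniqP ut) -(size_map val) tE size_map size_tuple.
- move=> h /andP[/eqP hk /eqP hm].
  have [t tE] : exists t : seq (finsupp m), map val t = [seq val i | i <- enum h].
    have H c : c \in [seq val i | i <- enum h] -> c \in finsupp m.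
      by rewrite -hm mem_finsupp_monomial.
    elim: [seq val i | i <- enum h] H => [|c s IHs] H; first by exists [::].
    have [|t tE] := IHs; first by move=> d ds; apply: H; rewrite inE ds orbT.
    by exists ([` H c (mem_head _ _)]%fset :: t); rewrite /= tE.
  have szt : size t == k by rewrite -(size_map val) tE size_map -cardE hk.
  exists (Tuple szt) => //=; rewrite tE hm eqxx andbT; exact: ord_ltn_sorted.
Qed.

Lemma represents_chromatic n (G : rel 'I_n) : represents (chromatic_qsym G)
  (\sum_(kappa : {ffun 'I_n -> 'I_N} | proper_colouring G (fun i => kappa i))
     ('X%:MP) ^+ asc G (fun i => kappa i) * \prod_(v : 'I_n) 'X_(kappa v)).
Proof.
move=> m sm; rewrite raddf_sum /=.
transitivity (\sum_(kappa : {ffun 'I_n -> 'I_N} | proper_colouring G (fun i => kappa i) &&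
   (monomial [seq val (kappa i) | i <- enum 'I_n] == m))
     'X^(asc G (fun i => kappa i)) : R); last first.
  rewrite big_mkcondr; apply: eq_bigr => kappa _.
  rewrite -rmorphXn mcoeffCM -big_enum /= (prod_mcoeff (enum 'I_n) kappa sm).
  by case: ifP; rewrite ?mulr1 ?mulr0.
rewrite /chromatic_qsym.
apply: (big_transfer (f1 := fun kappa : {ffun 'I_n -> finsupp m} => [ffun v => val (kappa v)])
     (f2 := fun kappa : {ffun 'I_n -> 'I_N} => [ffun v => val (kappa v)])).
- by move=> k1 k2 /ffunP E; apply/ffunP=> v; have := E v; rewrite !ffunE => /val_inj.
- by move=> k1 k2 /ffunP E; apply/ffunP=> v; have := E v; rewrite !ffunE => /val_inj.
- move=> kappa /andP[pr /eqP km].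
  have H v : (val (kappa v) < N)%N.
    by apply: (monomial_supported_mem sm km); apply/mapP; exists v; rewrite ?mem_enum.
  have E v : nat_of_ord ([ffun v => Ordinal (H v)] v) = val (kappa v) by rewrite ffunE.
  exists [ffun v => Ordinal (H v)]; last by apply/ffunP=> v; rewrite !ffunE.
  by rewrite (eq_proper_colouring _ E) pr (eq_map E) km eqxx.
- move=> kappa /andP[pr /eqP km].
  have H v : val (kappa v) \in finsupp m.
    by rewrite -km mem_finsupp_monomial; apply/mapP; exists v; rewrite ?mem_enum.
  have E v : val ([ffun v => [` H v]%fset] v) = val (kappa v) by rewrite ffunE.
  exists [ffun v => [` H v]%fset]; last by apply/ffunP=> v; rewrite !ffunE.
  by rewrite (eq_proper_colouring _ E) pr (eq_map E) km eqxx.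
move=> k1 k2 _ _ /ffunP E; congr ('X^_); apply: eq_asc => v.
by have := E v; rewrite !ffunE.
Qed.

End Coefficients.

(** * Types of forest triples are partitions of [n] *)

Section Types.
Local Open Scope nat_scope.
Variables (n : nat) (G : rel 'I_n).
Hypotheses (Gsym : symmetric G) (Girr : irreflexive G).

Lemma ftype_partition (F : preforest n) : F \in FT G -> is_partition n (ftype F).
Proof.
rewrite inE => /and3P[aF /forallP cF srt].
have fF : forest_on G setT F.
  by apply/and3P; split=> //; apply/forallP=> v; rewrite in_setT.
have pE := perm_sort geq (flatten [seq comp_of t | t <- F]).
apply/and3P; split.
- by apply: sort_sorted => a b; apply: leq_total.
- rewrite /ftype all_sort; apply/allP=> a /flatten_mapP[t tF].
  by have /and4P[_ /allP H _ _] := allP aF t tF; apply: H.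
rewrite /ftype (perm_sumn (permEl pE)) sumn_flatten -map_comp.
(* The sizes of the trees add up to [n] because the concatenated lists enumerate all vertices. *)
have /perm_size := forest_perm_enum Gsym Girr fF.
rewrite -cardE cardsT card_ord => szF; apply/eqP; apply: etrans szF.
rewrite size_flatten /shape -map_comp; congr sumn; apply/eq_in_map => t tF /=.
have tT := allP aF t tF; have /and4P[_ _ /eqP-> _] := tT.
rewrite (perm_size (tree_list_perm Gsym Girr (tree_triple_decreasing tT))).
by rewrite -cardE.
Qed.

Lemma partition_bseq (mu : seq nat) : is_partition n mu ->
  exists nu : {bseq n of 'I_n.+1}, map val nu = mu.
Proof.
move=> /and3P[_ pos /eqP sn].
have sz : size mu <= n.
  by rewrite -sn; elim: mu pos {sn} => [|a mu IHmu] //= /andP[a0 /IHmu]; lia.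
have le a : a \in mu -> a < n.+1.
  rewrite ltnS -sn; elim: mu {pos sn sz} => [|b mu IHmu] //=.
  by rewrite inE => /predU1P[->|/IHmu]; lia.
have [t tE] := seq_ord_ltn le.
have szt : size t <= n by rewrite -(size_map val) tE.
by exists (Bseq szt).
Qed.

End Types.

(** * Comparison of coefficients and the two expansions *)

Section ForestCoefficients.
Import mpoly.
Local Open Scope ring_scope.

(** Sign and power of [q] are scalars, so only the product of elementary symmetric functions meets
    the monomial. Sorting the parts into the type merely permutes its factors. *)
Lemma forest_term_coef n (G : rel 'I_n) M (F : preforest n) m : supported M.+1 m ->
  (forest_term G 'X%:MP (elsym (fun i : 'I_M.+1 => 'X_i : {mpoly {poly int}[M.+1]}) M.+1) F)@_(mnm_of M.+1 m)
  = fsign F * 'X^(fweight G F) * elem_sym_part (ftype F) m.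
Proof.
move=> sm; rewrite /forest_term /fsign /fweight inv_ninv.
have -> (k : nat) : (-1) ^+ k = ((-1) ^+ k)%:MP :> {mpoly {poly int}[M.+1]}.
  by rewrite rmorphXn rmorphN1.
rewrite -rmorphXn -rmorphM mcoeffCM; congr (_ * _).
rewrite -(perm_big _ (permEl (perm_sort geq _))) /=. apply/esym.
apply: (represents_prod _ _ sm) => k.
rewrite elsym_full; exact: represents_elem_sym.
Qed.

Lemma chromatic_forests n (G : rel 'I_n) : ssrbool.symmetric G -> irreflexive G ->
  natural_unit_interval G -> forall m, chromatic_qsym G m =
  \sum_(F in FT G) fsign F * 'X^(fweight G F) * elem_sym_part (ftype F) m.
Proof.
move=> Gsym Girr Gnui m.
(* The largest index of a variable in [m], or 0 for the trivial monomial; [M.+1] variables are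
   enough for this coefficient. *)
pose M := (\max_(c <- finsupp m) c)%N.
have sm : supported M.+1 m.
  move=> c cM; apply/mset_eq0P; apply: contraL cM => cm; rewrite -ltnNge ltnS.
  by rewrite /M (big_rem c) /= ?leq_maxl // multiset.msuppE.
rewrite (represents_chromatic G sm).
have := colourings_forests Gsym Girr Gnui ('X%:MP : {mpoly {poly int}[M.+1]}) (fun i => 'X_i).
move=> ->; rewrite raddf_sum /=; apply: eq_bigr => F _.
exact: forest_term_coef.
Qed.

End ForestCoefficients.

Theorem theorem3p4 (n : nat) (G : rel 'I_n) (Gsym : symmetric G)
    (Girr : irreflexive G) (Gnui : natural_unit_interval G) :
  (chromatic_qsym G =1
     fun m => (\sum_(F in FT G)
        fsign F * 'X^(fweight G F) * elem_sym_part (ftype F) m)%R)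
  /\
  ((fun m => (\sum_(F in FT G)
        fsign F * 'X^(fweight G F) * elem_sym_part (ftype F) m)%R) =1
   (fun m => (\sum_(mu : {bseq n of 'I_n.+1} | is_partition n (map val mu))
        (\sum_(F in FT_type G (map val mu)) fsign F * 'X^(fweight G F))
          * elem_sym_part (map val mu) m)%R)).
Proof.
split=> m; first exact: chromatic_forests.
pose g F := (fsign F * 'X^(fweight G F))%R : {poly int}.
under [RHS]eq_bigr do rewrite big_distrl /=.
rewrite [RHS](exchange_big_dep (fun F => F \in FT G)) /=; last first.
  by move=> mu F _; rewrite inE => /andP[].
apply: eq_bigr => F FG; have Fp := ftype_partition Gsym Girr FG.
have [nu nuE] := partition_bseq Fp.
(* A partition has only one encoding as a bounded sequence, so each forest triple is counted for a
   single [mu]. *)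
rewrite (big_pred1 nu) ?nuE // => mu; rewrite inE FG /= -nuE.
apply/andP/eqP => [[_ /eqP E]|->]; last by rewrite nuE Fp.
by apply/val_inj/(inj_map val_inj).
Qed.
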